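(* Let $K$ be a field, $S=K[x_1,\ldots,x_n]$, $E=K\langle y_1,\ldots,y_n\rangle$ the exterior algebra, and let $N^\bullet\in D^b(\operatorname{Sq}_E)$ be a bounded complex of squarefree $E$-modules. A pair $(F,i)\in 2^{[n]}\times\mathbb{Z}$ is distinguished for $N^\bullet$ if and only if $(F,2n-|F|-i)$ is distinguished for $\mathbf{D}_E(N^\bullet)$. If this is the case, then $$\dim_K H^i(\mathcal{L}(N^\bullet))_F=\dim_K H^{2n-|F|-i}(\mathcal{L}(\mathbf{D}_E(N^\bullet)))_F.$$
   Context: $[n]=\{1,\ldots,n\}$. $S$ is $\mathbb{Z}^n$-graded with $\deg x_i$ the $i$th unit vector, and $E$ is $\mathbb{Z}^n$-graded with $\deg y_i=-\deg x_i$. A subset $F\subset[n]$ is identified with its 0-1 indicator vector in $\mathbb{Z}^n$. For $\mathbf{a}\in\mathbb{Z}^n$, $\operatorname{supp}(\mathbf{a})=\{i\mid a_i>0\}$ and $|\mathbf{a}|=\sum a_i$; $\mathbf{1}=(1,\ldots,1)$; $M(\mathbf{a})_{\mathbf{b}}=M_{\mathbf{a}+\mathbf{b}}$. An $E$-module is a left and right module $N$ with $ea=(-1)^{(\deg e)(\deg a)}ae$ for homogeneous elements (total degrees). A $\mathbb{Z}^n$-graded $S$-module $M$ is squarefree if it is finitely generated, $M_{\mathbf{a}}=0$ for $\mathbf{a}\notin\mathbb{N}^n$, and multiplication by $\prod x_i^{b_i}$, $M_{\mathbf{a}}\to M_{\mathbf{a}+\mathbf{b}}$, is bijective for all $\mathbf{a},\mathbf{b}\in\mathbb{N}^n$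 with $\operatorname{supp}(\mathbf{a}+\mathbf{b})=\operatorname{supp}(\mathbf{a})$. $\operatorname{Sq}_S$ is the category of squarefree $S$-modules with degree-preserving maps; $D^b(\operatorname{Sq}_S)$ is identified with the bounded derived category of finitely generated $\mathbb{Z}^n$-graded $S$-modules with squarefree cohomology. A $\mathbb{Z}^n$-graded $E$-module $N$ is squarefree if it is finitely generated and $N=\bigoplus_{F\subset[n]}N_{-F}$; $\operatorname{Sq}_E$ is the category of these. For $N\in\operatorname{Sq}_E$, $N^*=\operatorname{Hom}_E(N,E)$ is again squarefree, $(-)^*$ is exact, and $\mathbf{D}_E$ is its extension to $D^b(\operatorname{Sq}_E)$, $\mathbf{D}_E(N^\bullet)^i=(N^{-i})^*$. For $N^\bullet\in D^b(\operatorname{Sq}_E)$ with differentials $\delta^i$, $\mathbf{L}(N^\bullet)$ is the complex of $\mathbb{Z}^n$-graded free $S$-modules $\mathbf{L}(N^\bullet)^m=\bigoplus_{i-|\mathbf{a}|=m}S\otimes_K N^i_{\mathbf{a}}$ with differential $1\otimes z\mapsto\sum_{l=1}^n x_l\otimes y_lz+(-1)^m(1\otimes\delta^i(z))$ for $z\in N^i_{\mathbf a}$. Then $\mathcal{L}(N^\bullet):=\mathbf{L}(N^\bullet)(-\mathbf{1})$ lies in $D^b(\operatorname{Sq}_S)$. For $F\subset[n]$ let $P_F=(x_i\mid i\notin F)$; for $M\in\operatorname{Sq}_S$, $P_F$ is a minimal prime of $M$ iff $F$ is a maximal element of $\{G\subset[n]\mid M_G\neq0\}$. A pair $(F,i)\in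 2^{[n]}\times\mathbb{Z}$ is a distinguished pair for $M^\bullet\in D^b(\operatorname{Sq}_S)$ if $P_F$ is a minimal prime of $H^i(M^\bullet)$ and $H^j(M^\bullet)_G=0$ for all $j<i$ and all $G\supset F$ with $|G|\geq|F|+i-j$. A pair $(F,i)$ is distinguished for $N^\bullet\in D^b(\operatorname{Sq}_E)$ if it is distinguished for $\mathcal{L}(N^\bullet)$. *)

(* Defs.v *)
From HB Require Import structures.
From mathcomp Require Import all_boot all_order all_algebra.
From mathcomp Require Import mpoly zify.

Set Implicit Arguments.
Unset Strict Implicit.
Unset Printing Implicit Defensive.

Import Order.TTheory GRing.Theory Num.Theory.
Import VectorInternalTheory.
Local Open Scope ring_scope.

(* The set [n] is 'I_n, and Z^n is Zn n.                                      *)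
Notation Zn n := {ffun 'I_n -> int}.

Section Degrees.
Variable n : nat.

Definition ind (F : {set 'I_n}) : Zn n := [ffun l => (l \in F)%:R].
Definition ones : Zn n := [ffun=> 1].
Definition tdeg (a : Zn n) : int := \sum_l a l.
Definition mdegZ (c : 'X_{1..n}) : Zn n := [ffun l => (c l)%:Z].

End Degrees.

(* -------------------------------------------------------------------------- *)
(* The exterior algebra E = K<y_1, ..., y_n>: an element is the family of its *)
(* coordinates on the basis extb F = y_{f_1} ... y_{f_k}, where               *)
(* F = {f_1 < ... < f_k}, and                                                 *)
(* extb F * extb G = (-1)^(number of inversions of (F, G)) extb (F :|: G)     *)
(* when F and G are disjoint, 0 otherwise.                                    *)

Definition ext (K : fieldType) (n : nat) : Type := {ffun {set 'I_n} -> K^o}.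

Section ExteriorAlgebra.
Variables (K : fieldType) (n : nat).
Local Notation E := (ext K n).

HB.instance Definition _ := Vector.copy E {ffun {set 'I_n} -> K^o}.

Definition extb (F : {set 'I_n}) : E := [ffun G => (G == F)%:R].

Definition inv_count (F G : {set 'I_n}) : nat :=
  #|[set p : 'I_n * 'I_n | [&& p.1 \in F, p.2 \in G & (p.2 < p.1)%N]]|.

Definition extc (F G : {set 'I_n}) : K :=
  if [disjoint F & G] then (-1) ^+ inv_count F G else 0.

Definition ext_mul (u v : E) : E :=
  \sum_F \sum_G ((u F : K) * v G * extc F G) *: extb (F :|: G).

Lemma extE (u : E) : u = \sum_F (u F : K) *: extb F.
Proof.
apply/ffunP => G; rewrite sum_ffunE (bigD1 G) //= big1 ?addr0.
  by rewrite !ffunE eqxx [_ *: _]mulr1.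
by move=> F neqF; rewrite !ffunE eq_sym (negbTE neqF) [_ *: _]mulr0.
Qed.

Fact ext_mulDl : left_distributive ext_mul +%R.
Proof.
move=> u v w; rewrite /ext_mul -big_split; apply: eq_bigr => F _ /=.
rewrite -big_split; apply: eq_bigr => G _ /=.
by rewrite -scalerDl !ffunE !mulrDl.
Qed.

Fact ext_mulDr : right_distributive ext_mul +%R.
Proof.
move=> u v w; rewrite /ext_mul -big_split; apply: eq_bigr => F _ /=.
rewrite -big_split; apply: eq_bigr => G _ /=.
by rewrite -scalerDl !ffunE mulrDr mulrDl.
Qed.

Fact ext_mulZl (k : K) (u v : E) : k *: ext_mul u v = ext_mul (k *: u) v.
Proof.
rewrite /ext_mul scaler_sumr; apply: eq_bigr => F _.
rewrite scaler_sumr; apply: eq_bigr => G _.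
by rewrite scalerA !ffunE -!mulrA.
Qed.

Fact ext_mulZr (k : K) (u v : E) : k *: ext_mul u v = ext_mul u (k *: v).
Proof.
rewrite /ext_mul scaler_sumr; apply: eq_bigr => F _.
rewrite scaler_sumr; apply: eq_bigr => G _.
rewrite scalerA (_ : (k *: v) G = k * v G) ?ffunE //.
by rewrite (mulrCA (u F)) -!mulrA.
Qed.

Lemma ext_mulbb (F G : {set 'I_n}) :
  ext_mul (extb F) (extb G) = extc F G *: extb (F :|: G).
Proof.
rewrite /ext_mul (bigD1 F) //= (bigD1 G) //= !ffunE !eqxx !mul1r.
rewrite big1 ?addr0 => [|H neqH]; last first.
  by rewrite !ffunE (negbTE neqH) mulr0 mul0r scale0r.
rewrite big1 ?addr0 // => H neqH; apply: big1 => H' _.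
by rewrite !ffunE (negbTE neqH) !mul0r scale0r.
Qed.

Lemma inv_countUl (F G H : {set 'I_n}) : [disjoint F & G] ->
  inv_count (F :|: G) H = (inv_count F H + inv_count G H)%N.
Proof.
move=> dFG; rewrite /inv_count -cardsUI [X in (_ + X)%N]eq_card0 ?addn0.
  apply: eq_card => -[i j]; rewrite !inE /=.
  by case: (i \in F); case: (i \in G); case: (j \in H); case: (_ < _)%N.
move=> [i j]; rewrite !inE /=; apply/negbTE/negP.
by case/andP=> /and3P[iF _ _] /and3P[iG _ _]; rewrite (disjointFr dFG iF) in iG.
Qed.


Lemma inv_countUr (F G H : {set 'I_n}) : [disjoint G & H] ->
  inv_count F (G :|: H) = (inv_count F G + inv_count F H)%N.
Proof.
move=> dGH; rewrite /inv_count -cardsUI [X in (_ + X)%N]eq_card0 ?addn0.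
  apply: eq_card => -[i j]; rewrite !inE /=.
  by case: (i \in F); case: (j \in G); case: (j \in H); case: (_ < _)%N.
move=> [i j]; rewrite !inE /=; apply/negbTE/negP.
by case/andP=> /and3P[_ jG _] /and3P[_ jH _]; rewrite (disjointFr dGH jG) in jH.
Qed.

Lemma disjointsUl (F G H : {set 'I_n}) :
  [disjoint F :|: G & H] = [disjoint F & H] && [disjoint G & H].
Proof. by rewrite -!setI_eq0 setIUl setU_eq0. Qed.

Lemma disjointsUr (F G H : {set 'I_n}) :
  [disjoint F & G :|: H] = [disjoint F & G] && [disjoint F & H].
Proof. by rewrite -!setI_eq0 setIUr setU_eq0. Qed.

Lemma extcA (F G H : {set 'I_n}) :
  extc F G * extc (F :|: G) H = extc G H * extc F (G :|: H).
Proof.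
rewrite /extc disjointsUl disjointsUr.
case: (boolP [disjoint F & G]) => dFG; case: (boolP [disjoint G & H]) => dGH;
  rewrite ?andbF ?andbT ?mul0r ?mulr0 //=.
case: ifP => dFH; rewrite ?mulr0 // -!exprD inv_countUl // inv_countUr //.
by congr (_ ^+ _); lia.
Qed.

Lemma ext_mul_suml (I : finType) (x : I -> E) v :
  ext_mul (\sum_i x i) v = \sum_i ext_mul (x i) v.
Proof.
apply: (big_morph (ext_mul^~ v)) => [a b|]; first exact: ext_mulDl.
by have := ext_mulZl 0 0 v; rewrite !scale0r => <-.
Qed.

Lemma ext_mul_sumr (I : finType) (x : I -> E) v :
  ext_mul v (\sum_i x i) = \sum_i ext_mul v (x i).
Proof.
apply: (big_morph (ext_mul v)) => [a b|]; first exact: ext_mulDr.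
by have := ext_mulZr 0 v 0; rewrite !scale0r => <-.
Qed.

Fact ext_mulA : associative ext_mul.
Proof.
move=> u v w; rewrite {1}[u]extE {2}[u]extE.
rewrite !(ext_mul_suml (fun F => (u F : K) *: extb F)).
rewrite (ext_mul_suml (fun F => ext_mul ((u F : K) *: extb F) v)).
apply: eq_bigr => F _; rewrite -!ext_mulZl; congr (_ *: _).
rewrite {1}[v]extE {2}[v]extE (ext_mul_suml (fun F => (v F : K) *: extb F)).
rewrite (ext_mul_sumr (fun F => ext_mul ((v F : K) *: extb F) w)).
rewrite (ext_mul_sumr (fun F => (v F : K) *: extb F)).
rewrite (ext_mul_suml (fun G => ext_mul (extb F) ((v G : K) *: extb G))).
apply: eq_bigr => G _; rewrite -ext_mulZl -!ext_mulZr -ext_mulZl.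
congr (_ *: _); rewrite {1}[w]extE {2}[w]extE.
rewrite !(ext_mul_sumr (fun F => (w F : K) *: extb F)).
rewrite (ext_mul_sumr (fun H => ext_mul (extb G) ((w H : K) *: extb H))).
apply: eq_bigr => H _; rewrite -!ext_mulZr; congr (_ *: _).
by rewrite !ext_mulbb -ext_mulZr -ext_mulZl !ext_mulbb !scalerA setUA extcA.
Qed.

Lemma inv_count0l F : inv_count set0 F = 0%N.
Proof. by apply: eq_card0 => p; rewrite !inE. Qed.

Lemma inv_count0r F : inv_count F set0 = 0%N.
Proof. by apply: eq_card0 => p; rewrite !inE andbF. Qed.

Fact ext_mul1l : left_id (extb set0) ext_mul.
Proof.
move=> u; rewrite [RHS]extE {1}[u]extE.
rewrite (ext_mul_sumr (fun F => (u F : K) *: extb F)); apply: eq_bigr => F _.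
rewrite -ext_mulZr ext_mulbb set0U /extc -setI_eq0 set0I eqxx.
by rewrite inv_count0l scale1r.
Qed.

Fact ext_mul1r : right_id (extb set0) ext_mul.
Proof.
move=> u; rewrite [RHS]extE {1}[u]extE.
rewrite (ext_mul_suml (fun F => (u F : K) *: extb F)); apply: eq_bigr => F _.
rewrite -ext_mulZl ext_mulbb setU0 /extc -setI_eq0 setI0 eqxx.
by rewrite inv_count0r scale1r.
Qed.

Fact ext_1_neq0 : extb set0 != 0.
Proof.
by apply/eqP => /ffunP/(_ set0); rewrite !ffunE eqxx; apply/eqP/oner_neq0.
Qed.

HB.instance Definition _ := GRing.Zmodule_isNzRing.Build E
  ext_mulA ext_mul1l ext_mul1r ext_mulDl ext_mulDr ext_1_neq0.
HB.instance Definition _ := GRing.Lmodule_isLalgebra.Build K E ext_mulZl.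
HB.instance Definition _ := GRing.Lalgebra_isAlgebra.Build K E ext_mulZr.

Definition exty (l : 'I_n) : E := extb [set l].

Lemma exty_sqr l : exty l * exty l = 0.
Proof.
rewrite [LHS]ext_mulbb /extc ifF ?scale0r //.
by rewrite -setI_eq0 setIid -cards_eq0 cards1.
Qed.

Lemma exty_anti k l : exty k * exty l = - (exty l * exty k).
Proof.
have [->|neqkl] := eqVneq k l; first by rewrite exty_sqr oppr0.
rewrite [LHS]ext_mulbb [X in - X]ext_mulbb setUC -scaleNr; congr (_ *: _).
have invE i j : inv_count [set i] [set j] = (j < i)%N.
  rewrite /inv_count; have [ltji|leij] := ltnP j i.
    transitivity #|[set (i, j)]|; last by rewrite cards1.
    apply: eq_card => -[a b]; rewrite !inE xpair_eqE /=.
    by case: eqP => // ->; case: eqP => //= ->; rewrite ltji.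
  apply: eq_card0 => -[a b]; rewrite !inE /=; apply/negP.
  by case/and3P=> /eqP-> /eqP->; rewrite ltnNge leij.
rewrite /extc !disjoints1 !inE (eq_sym l) neqkl !invE.
by case: ltngtP neqkl => [||/val_inj->]; rewrite ?eqxx // ?expr0 ?expr1 ?opprK.
Qed.

Lemma extb_prod (F : {set 'I_n}) : extb F = \prod_(l <- enum F) exty l.
Proof.
have: sorted (fun i j : 'I_n => i < j)%N (enum F).
  apply: sorted_filter; first by move=> ? ? ?; apply: ltn_trans.
  have := iota_ltn_sorted 0 n; rewrite -val_enum_ord sorted_map enumT.
  exact.
rewrite -[in extb F](set_enum F); move: (enum F) => s {F}; elim: s => [_|k s IHs ks].
  by rewrite big_nil; congr extb; apply/setP => l; rewrite !inE.
rewrite big_cons -IHs ?(path_sorted ks) // [RHS]ext_mulbb.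
have lt_k l : l \in s -> (k < l)%N.
  have tr : transitive (fun i j : 'I_n => i < j)%N by move=> ? ? ?; apply: ltn_trans.
  exact: (allP (order_path_min tr ks)).
rewrite /extc disjoints1 inE; case: ifPn => [_|]; last first.
  by rewrite negbK => /lt_k; rewrite ltnn.
rewrite (_ : inv_count _ _ = 0%N) ?scale1r.
  by congr extb; apply/setP => l; rewrite !inE.
apply: eq_card0 => -[a b]; rewrite !inE; apply/negP => /and3P[/eqP-> /lt_k].
by move=> /ltnW; rewrite leqNgt => /negbTE->.
Qed.

(* deg y_l = - ind [set l], hence extb F has degree - ind F.                  *)
Definition ext_hom (a : Zn n) (e : E) : Prop :=
  forall F, e F != 0 -> a = - ind F.

End ExteriorAlgebra.

(* -------------------------------------------------------------------------- *)
(* E has finite dimension over K, so the finitely generated left and right    *)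
(* E-modules are the ones with an underlying vectType K. The relation         *)
(* e a = (-1)^(|e| |a|) a e needs a grading, see squarefree_complex.          *)

Record bimodE (K : fieldType) (n : nat) := BimodE {
  bimod_car :> vectType K;
  lact : {linear ext K n -> 'End(bimod_car)};
  ract : {linear ext K n -> 'End(bimod_car)};
  lact1 : lact 1 = \1%VF;
  lactM : forall e f, lact (e * f) = (lact e \o lact f)%VF;
  ract1 : ract 1 = \1%VF;
  ractM : forall e f, ract (e * f) = (ract f \o ract e)%VF;
  lractC : forall e f, (lact e \o ract f = ract f \o lact e)%VF
}.

(* N^* = Hom_E(N, E), the maps f with f (v e) = (f v) e, as an E-module by    *)
(* (e f) v = e (f v) and (f e) v = f (e v).                                   *)

Section Dual.
Variables (K : fieldType) (n : nat) (N : bimodE K n).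
Local Notation E := (ext K n).

Definition lmulE (e : E) : 'End(E) := linfun (fun u : E => e * u).
Definition rmulE (e : E) : 'End(E) := linfun (fun u : E => u * e).

Lemma lmulEE e u : lmulE e u = e * u.
Proof.
have lin : linear (fun u : E => e * u) by move=> k x y; rewrite mulrDr scalerAr.
pose f : {linear E -> E} := HB.pack (fun u : E => e * u)
  (GRing.isLinear.Build K E E *:%R (fun u : E => e * u) lin).
exact: (lfunE f u).
Qed.

Lemma rmulEE e u : rmulE e u = u * e.
Proof.
have lin : linear (fun u : E => u * e) by move=> k x y; rewrite mulrDl scalerAl.
pose f : {linear E -> E} := HB.pack (fun u : E => u * e)
  (GRing.isLinear.Build K E E *:%R (fun u : E => u * e) lin).
exact: (lfunE f u).
Qed.

Definition rlin_defect (e : E) (f : 'Hom(N, E)) : 'Hom(N, E) :=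
  (f \o ract N e)%VF - (rmulE e \o f)%VF.

Lemma rlin_defectE e f v : rlin_defect e f v = f (ract N e v) - f v * e.
Proof. by rewrite add_lfunE opp_lfunE !comp_lfunE rmulEE. Qed.

Fact rlin_defect_is_linear e : linear (rlin_defect e).
Proof.
move=> k f g; apply/lfunP => v.
rewrite [LHS]rlin_defectE (add_lfunE (k *: rlin_defect e f)) scale_lfunE.
rewrite !rlin_defectE !add_lfunE !scale_lfunE.
by rewrite mulrDl -scalerAl scalerBr opprD addrACA.
Qed.
HB.instance Definition _ e := GRing.isLinear.Build K 'Hom(N, E) 'Hom(N, E)
  *:%R (rlin_defect e) (rlin_defect_is_linear e).

Definition homE : {vspace 'Hom(N, E)} :=
  (\bigcap_F lker (linfun (rlin_defect (extb K F))))%VS.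

Lemma homEP (f : 'Hom(N, E)) :
  reflect (forall e v, f (ract N e v) = f v * e) (f \in homE).
Proof.
apply: (iffP idP) => [|fr].
  rewrite memvE => /subv_bigcapP fF e v.
  have fb F : f (ract N (extb K F) v) = f v * extb K F.
    have := fF F isT; rewrite -memvE memv_ker lfunE /= => /eqP/lfunP/(_ v).
    by rewrite rlin_defectE zero_lfunE => /eqP; rewrite subr_eq0 => /eqP.
  rewrite [e]extE linear_sum sum_lfunE linear_sum mulr_sumr.
  apply: eq_bigr => F _.
  by rewrite linearZ /= lfunE /= linearZ /= fb scalerAr.
rewrite memvE; apply/subv_bigcapP => F _; rewrite -memvE memv_ker lfunE /=.
by apply/eqP/lfunP => v; rewrite rlin_defectE zero_lfunE fr subrr.
Qed.

Lemma homE_l e (f : 'Hom(N, E)) : f \in homE -> (lmulE e \o f)%VF \in homE.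
Proof.
move=> /homEP fr; apply/homEP => e' v.
by rewrite !comp_lfunE fr !lmulEE mulrA.
Qed.

Lemma homE_r e (f : 'Hom(N, E)) : f \in homE -> (f \o lact N e)%VF \in homE.
Proof.
move=> /homEP fr; apply/homEP => e' v; rewrite !comp_lfunE.
by have /lfunP/(_ v) := lractC N e e'; rewrite !comp_lfunE => ->; apply: fr.
Qed.

Local Notation H := (subvs_of homE).

Definition dual_lactf (e : E) (f : H) : H := vsproj homE (lmulE e \o vsval f)%VF.
Definition dual_ractf (e : E) (f : H) : H :=
  vsproj homE (vsval f \o lact N e)%VF.

Lemma dual_lactfE e f v : vsval (dual_lactf e f) v = e * vsval f v.
Proof. by rewrite vsprojK ?homE_l ?subvsP // comp_lfunE lmulEE. Qed.

Lemma dual_ractfE e f v : vsval (dual_ractf e f) v = vsval f (lact N e v).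
Proof. by rewrite vsprojK ?homE_r ?subvsP // comp_lfunE. Qed.

Lemma dual_eq (f g : H) : (forall v, vsval f v = vsval g v) -> f = g.
Proof. by move=> eqfg; apply/subvs_inj/lfunP. Qed.

Fact dual_lactf_is_linear e : linear (dual_lactf e).
Proof.
move=> k f g; apply: dual_eq => v; rewrite linearP add_lfunE scale_lfunE.
by rewrite !dual_lactfE linearP add_lfunE scale_lfunE mulrDr scalerAr.
Qed.
HB.instance Definition _ e := GRing.isLinear.Build K H H *:%R (dual_lactf e)
  (dual_lactf_is_linear e).

Fact dual_ractf_is_linear e : linear (dual_ractf e).
Proof.
move=> k f g; apply: dual_eq => v; rewrite linearP add_lfunE scale_lfunE.
by rewrite !dual_ractfE linearP add_lfunE scale_lfunE.
Qed.
HB.instance Definition _ e := GRing.isLinear.Build K H H *:%R (dual_ractf e)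
  (dual_ractf_is_linear e).

Definition dual_lact (e : E) : 'End(H) := linfun (dual_lactf e).
Definition dual_ract (e : E) : 'End(H) := linfun (dual_ractf e).

Lemma dual_lactE e f v : vsval (dual_lact e f) v = e * vsval f v.
Proof. by rewrite lfunE dual_lactfE. Qed.

Lemma dual_ractE e f v : vsval (dual_ract e f) v = vsval f (lact N e v).
Proof. by rewrite lfunE dual_ractfE. Qed.

Fact dual_lact_is_linear : linear dual_lact.
Proof.
move=> k e e'; apply/lfunP => f; apply: dual_eq => v.
rewrite add_lfunE scale_lfunE linearP add_lfunE scale_lfunE !dual_lactE.
by rewrite mulrDl scalerAl.
Qed.
HB.instance Definition _ := GRing.isLinear.Build K E 'End(H) *:%R dual_lact
  dual_lact_is_linear.

Fact dual_ract_is_linear : linear dual_ract.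
Proof.
move=> k e e'; apply/lfunP => f; apply: dual_eq => v.
rewrite add_lfunE scale_lfunE linearP add_lfunE scale_lfunE !dual_ractE.
by rewrite linearP add_lfunE scale_lfunE linearP.
Qed.
HB.instance Definition _ := GRing.isLinear.Build K E 'End(H) *:%R dual_ract
  dual_ract_is_linear.

Fact dual_lact1 : dual_lact 1 = \1%VF.
Proof.
by apply/lfunP => f; apply: dual_eq => v; rewrite dual_lactE mul1r id_lfunE.
Qed.

Fact dual_lactM e e' : dual_lact (e * e') = (dual_lact e \o dual_lact e')%VF.
Proof.
by apply/lfunP => f; apply: dual_eq => v; rewrite comp_lfunE !dual_lactE mulrA.
Qed.

Fact dual_ract1 : dual_ract 1 = \1%VF.
Proof.
by apply/lfunP => f; apply: dual_eq => v; rewrite dual_ractE lact1 !id_lfunE.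
Qed.

Fact dual_ractM e e' : dual_ract (e * e') = (dual_ract e' \o dual_ract e)%VF.
Proof.
apply/lfunP => f; apply: dual_eq => v.
by rewrite comp_lfunE !dual_ractE lactM comp_lfunE.
Qed.

Fact dual_lractC e e' :
  (dual_lact e \o dual_ract e' = dual_ract e' \o dual_lact e)%VF.
Proof.
apply/lfunP => f; apply: dual_eq => v.
by rewrite !comp_lfunE dual_lactE !dual_ractE dual_lactE.
Qed.

Definition dualE : bimodE K n := @BimodE K n H dual_lact dual_ract
  dual_lact1 dual_lactM dual_ract1 dual_ractM dual_lractC.

End Dual.

(* -------------------------------------------------------------------------- *)

(* V is the direct sum of the subgroups {v | h p v}, for p in I.              *)
Record is_grading (I : eqType) (V : zmodType) (h : I -> V -> Prop) : Prop := {
  grading0 : forall p, h p 0;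
  gradingB : forall p u v, h p u -> h p v -> h p (u - v);
  grading_span : forall v, exists (s : seq I) (f : I -> V),
    (forall p, h p (f p)) /\ v = \sum_(p <- s) f p;
  grading_direct : forall (s : seq I) (f : I -> V), uniq s ->
    (forall p, h p (f p)) -> \sum_(p <- s) f p = 0 -> {in s, forall p, f p = 0}
}.

(* A bounded complex N of finitely generated Z^n-graded E-modules is encoded  *)
(* by the total module \bigoplus_i N^i, which again has finite dimension,     *)
(* with its homogeneous parts: ecomp i a v means that v is in N^i_a. The      *)
(* differential is the sum of the maps delta^i. That ecomp does define a      *)
(* grading compatible with the rest is part of squarefree_complex.            *)

Record Ecomplex (K : fieldType) (n : nat) := EComplex {
  etot :> bimodE K n;
  ecomp : int -> Zn n -> etot -> Prop;
  ediff : 'End(etot);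
  ediff_lact : forall e, (ediff \o lact etot e = lact etot e \o ediff)%VF;
  ediff_ract : forall e, (ediff \o ract etot e = ract etot e \o ediff)%VF;
  ediffK : (ediff \o ediff = 0)%VF
}.

Record squarefree_complex (K : fieldType) (n : nat) (N : Ecomplex K n) : Prop := {
  sqE_grading : is_grading (fun p : int * Zn n => @ecomp _ _ N p.1 p.2);
  sqE_lact : forall i a b e (v : N),
    ext_hom a e -> ecomp i b v -> ecomp i (a + b) (lact N e v);
  sqE_sign : forall i a b e (v : N), ext_hom a e -> ecomp i b v ->
    lact N e v = (-1) ^+ `|(tdeg a * tdeg b)%R|%N *: ract N e v;
  sqE_diff : forall i a (v : N), ecomp i a v -> ecomp (i + 1) a (ediff N v);
  sqE_supp : forall i a (v : N), ecomp i a v -> v != 0 ->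
    exists F : {set 'I_n}, a = - ind F
}.

(* D_E(N) has total module Hom_E(\bigoplus_i N^i, E) = \bigoplus_i (N^i)^*;   *)
(* its part (N^-i)^*_a consists of the maps f that vanish on N^j for          *)
(* j != - i and send N^(-i)_b to E_(a + b).                                   *)

Section DualComplex.
Variables (K : fieldType) (n : nat) (N : Ecomplex K n).
Local Notation H := (dualE N).

Definition dual_comp (i : int) (a : Zn n) (f : H) : Prop :=
  forall j b (v : N), ecomp j b v ->
    if j == - i then ext_hom (a + b) (vsval f v) else vsval f v = 0.

Definition dual_difff (f : H) : H := vsproj (homE N) (vsval f \o ediff N)%VF.

Lemma dual_difffE f v : vsval (dual_difff f) v = vsval f (ediff N v).
Proof.
rewrite vsprojK ?comp_lfunE //; apply/homEP => e w; rewrite !comp_lfunE.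
have /lfunP/(_ w) := ediff_ract N e; rewrite !comp_lfunE => ->.
exact/homEP/subvsP.
Qed.

Fact dual_difff_is_linear : linear dual_difff.
Proof.
move=> k f g; apply: dual_eq => v.
rewrite linearP add_lfunE scale_lfunE !dual_difffE.
by rewrite linearP add_lfunE scale_lfunE.
Qed.
HB.instance Definition _ := GRing.isLinear.Build K H H *:%R dual_difff
  dual_difff_is_linear.

Definition dual_diff : 'End(H) := linfun dual_difff.

Lemma dual_diffE f v : vsval (dual_diff f) v = vsval f (ediff N v).
Proof. by rewrite lfunE dual_difffE. Qed.

Fact dual_diff_lact e : (dual_diff \o lact H e = lact H e \o dual_diff)%VF.
Proof.
apply/lfunP => f; apply: dual_eq => v.
by rewrite !comp_lfunE dual_diffE !dual_lactE dual_diffE.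
Qed.

Fact dual_diff_ract e : (dual_diff \o ract H e = ract H e \o dual_diff)%VF.
Proof.
apply/lfunP => f; apply: dual_eq => v.
rewrite !comp_lfunE dual_diffE !dual_ractE dual_diffE.
by have /lfunP/(_ v) := ediff_lact N e; rewrite !comp_lfunE => ->.
Qed.

Fact dual_diffK : (dual_diff \o dual_diff = 0)%VF.
Proof.
apply/lfunP => f; apply: dual_eq => v; rewrite comp_lfunE !dual_diffE.
have /lfunP/(_ v) := ediffK N; rewrite comp_lfunE !zero_lfunE => ->.
exact: linear0.
Qed.

Definition DE : Ecomplex K n := @EComplex K n H dual_comp dual_diff
  dual_diff_lact dual_diff_ract dual_diffK.

End DualComplex.

(* -------------------------------------------------------------------------- *)
(* A complex M of Z^n-graded S-modules: Scar is \bigoplus_i M^i, scomp i a z  *)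
(* means that z is in M^i_a, and sdiff i is only meaningful on M^i. This is   *)
(* raw data: the axioms hold for L(N) below when N is squarefree.             *)

Record Scomplex (K : fieldType) (n : nat) := SComplex {
  Scar :> lmodType {mpoly K[n]};
  scomp : int -> Zn n -> Scar -> Prop;
  sdiff : int -> {linear Scar -> Scar}
}.

Section Distinguished.
Variables (K : fieldType) (n : nat) (M : Scomplex K n).
Local Notation S := {mpoly K[n]}.
Implicit Types (i j : int) (a : Zn n) (F G : {set 'I_n}).

(* M(v)_a = M_(v + a)                                                         *)
Definition Sshift (v : Zn n) : Scomplex K n :=
  @SComplex K n M (fun i a => @scomp _ _ M i (v + a)) (@sdiff _ _ M).

Definition cocycle i a (z : M) : Prop := scomp i a z /\ sdiff M i z = 0.
Definition coboundary i a (z : M) : Prop :=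
  exists2 w : M, scomp (i - 1) a w & sdiff M (i - 1) w = z.

(* H^i(M)_a = 0                                                               *)
Definition cohom_zero i a : Prop := forall z, cocycle i a z -> coboundary i a z.

(* dim_K H^i(M)_a = d: the classes of some cocycles z_1, ..., z_d form a      *)
(* K-basis of H^i(M)_a.                                                       *)
Definition cohom_dim i a (d : nat) : Prop :=
  exists2 z : 'I_d -> M, (forall k, cocycle i a (z k)) &
    forall u, cocycle i a u ->
      exists! c : {ffun 'I_d -> K}, coboundary i a (u - \sum_k (c k)%:MP *: z k).

Definition sterm i (z : M) : Prop :=
  exists (s : seq (Zn n)) (f : Zn n -> M),
    (forall a, scomp i a (f a)) /\ z = \sum_(a <- s) f a.

Definition cohom_ann i (s : S) : Prop :=
  forall z, sterm i z -> sdiff M i z = 0 ->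
    exists2 w, sterm (i - 1) w & sdiff M (i - 1) w = s *: z.

Record prime_ideal (Q : S -> Prop) : Prop := {
  prime_ideal0 : Q 0;
  prime_idealD : forall s t, Q s -> Q t -> Q (s + t);
  prime_idealM : forall s t, Q t -> Q (s * t);
  prime_ideal1 : ~ Q 1;
  prime_ideal_prime : forall s t, Q (s * t) -> Q s \/ Q t
}.

(* Q is a minimal element of the support of H^i(M), that is, a minimal prime  *)
(* over its annihilator.                                                      *)
Definition cohom_minimal_prime i (Q : S -> Prop) : Prop :=
  [/\ prime_ideal Q, (forall s, cohom_ann i s -> Q s) &
      forall Q' : S -> Prop, prime_ideal Q' ->
        (forall s, cohom_ann i s -> Q' s) -> (forall s, Q' s -> Q s) ->
        forall s, Q s -> Q' s].

Definition Pideal F (s : S) : Prop :=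
  exists h : 'I_n -> S, s = \sum_(l | l \notin F) h l * 'X_l.

Definition distinguished F i : Prop :=
  cohom_minimal_prime i (Pideal F) /\
  forall j G, j < i -> F \subset G -> #|F|%:Z + i - j <= #|G|%:Z ->
    cohom_zero j (ind G).

End Distinguished.

(* -------------------------------------------------------------------------- *)
(* For a K-vector space V with canonical basis v_1, ..., v_d, the free module *)
(* S \otimes_K V is the space of row vectors 'rV[S]_d, s \otimes v being      *)
(* s *: tens v; S \otimes f is right multiplication by tensf f.               *)

Section Tensor.
Variables (K : fieldType) (n : nat).
Local Notation S := {mpoly K[n]}.
Implicit Types V W : vectType K.

Definition tens V (v : V) : 'rV[S]_(dim V) := map_mx (@mpolyC n K) (v2r v).

Definition tensf V W (f : 'Hom(V, W)) : 'M[S]_(dim V, dim W) :=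
  map_mx (@mpolyC n K) (f2mx f).

Lemma tensfE V W (f : 'Hom(V, W)) (v : V) : tens v *m tensf f = tens (f v).
Proof. by rewrite /tens unlock /= r2vK map_mxM. Qed.

(* The z_c in w = \sum_c x^c \otimes z_c.                                     *)
Definition tcoef V (c : 'X_{1..n}) (w : 'rV[S]_(dim V)) : V :=
  r2v (map_mx (mcoeff c) w).

End Tensor.

(* L(N) lives on the free module S \otimes \bigoplus_i N^i. Since x^c         *)
(* \otimes N^i_a has cohomological degree i - |a| and Z^n-degree a + c, the   *)
(* part L(N)^m_b consists of the \sum_c x^c \otimes z_c with z_c in N^i_a for *)
(* a = b - c and i = m + |a|.                                                 *)

Section L.
Variables (K : fieldType) (n : nat) (N : Ecomplex K n).
Local Notation S := {mpoly K[n]}.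

Definition L_comp (m : int) (b : Zn n) (w : 'rV[S]_(dim N)) : Prop :=
  forall c : 'X_{1..n}, let a := b - mdegZ c in
    ecomp (m + tdeg a) a (tcoef c w : N).

Definition L_mx (m : int) : 'M[S]_(dim N) :=
  \sum_l 'X_l *: tensf n (lact N (exty K l))
    + (-1) ^+ `|m|%N *: tensf n (ediff N).

Lemma L_mxE m (z : N) : tens n z *m L_mx m =
  \sum_l 'X_l *: tens n (lact N (exty K l) z)
    + (-1) ^+ `|m|%N *: tens n (ediff N z).
Proof.
rewrite mulmxDr mulmx_sumr -scalemxAr tensfE; congr (_ + _).
by apply: eq_bigr => l _; rewrite -scalemxAr tensfE.
Qed.

Definition Lcomplex : Scomplex K n :=
  @SComplex K n 'rV[S]_(dim N) L_comp (fun m => mulmxr (L_mx m)).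

Definition calL : Scomplex K n := Sshift Lcomplex (- ones n).

End L.

Definition distinguishedE (K : fieldType) (n : nat) (N : Ecomplex K n)
  (F : {set 'I_n}) (i : int) : Prop := distinguished (calL N) F i.

(* Main.v *)
From HB Require Import structures.
From Stdlib Require Import Classical_Prop.
Require Import Defs.
From mathcomp Require Import all_boot all_order all_algebra.
From mathcomp Require Import mpoly zify.

Set Implicit Arguments.
Unset Strict Implicit.
Unset Printing Implicit Defensive.

Import Order.TTheory GRing.Theory Num.Theory.
Import VectorInternalTheory.
Local Open Scope ring_scope.

(** In degree [b >= 0] with support [G], setting all [x_l] to 1 identifies
    [calL N] with the complex of vector spaces [\bigoplus_B N_(-B)] over the [B]
    containing the complement of [G], with differential [\sum_l y_l +/- delta].
    This differential only enlarges [B], so that there is a subquotient complex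
    [X(U, W)] for every interval [U <= B <= W] of subsets, and an exact sequence
    [0 -> X(l + U, W) -> X(U, W) -> X(U, W - l) -> 0] for [l \in W - U].

    The pair [(F, i)] is distinguished for [N] when [H^i(X(~F, [n]))] is not 0
    and [H^j(X(U, [n])) = 0] for [U] strictly contained in [~F] and
    [i - n + |F| + |U| <= j <= i]. By descending induction on [W], this is
    equivalent to the vanishing of [H^j(X(U, W))] for
    [i - n + |F| + |U| <= j <= i - n + |W|] and [U + F] strictly contained in
    [W], a condition which is likewise determined by the case [U = 0]. The
    connecting maps then show that [H^(i - n + |F| + |U|)(X(U, U + F))] does not
    depend on [U] up to isomorphism; the extreme cases are [H^i(X(~F, [n]))] and
    [H^(i - n + |F|)(X(0, F))]. On the other hand the coefficient of
    [y_1 ... y_n] in [f v], for [f] in [N^*], defines a perfect pairing which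
    makes the complex of [D_E N] in degree [G] dual to [X(0, G)]. *)

(** * Dimension counts for subquotients and exact sequences *)

Section ThreeTermExactness.
Variables (K : fieldType) (V : vectType K).
Implicit Types (A B Z : {vspace V}) (f g : 'End(V)).

(** The map from A/B to f(A)/f(B) induced by [f] is onto. *)
Lemma dim_quotient_img f A B : (B <= A)%VS ->
  (\dim (f @: A) - \dim (f @: B) <= \dim A - \dim B)%N.
Proof.
move=> sBA; have := limg_ker_dim f A; have := limg_ker_dim f B.
have := dimvS (capvS sBA (subvv (lker f))); have := dimvS sBA.
have := dimvS (limgS f sBA); lia.
Qed.

(** Dividing [A] by the preimage of [B] makes the map to Z/B induced by [f] injective. *)
Lemma dim_quotient_preim f A Z B : (B <= Z)%VS -> (f @: A <= Z)%VS ->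
  (\dim A - \dim (A :&: (f @^-1: B)) <= \dim Z - \dim B)%N.
Proof.
move=> sBZ sfAZ; set T := (A :&: _)%VS.
have kT : (T :&: lker f = A :&: lker f)%VS.
  rewrite /T -capvA; congr (_ :&: _)%VS; apply/capv_idPr.
  by rewrite -lpreim0 lpreimS // sub0v.
have := limg_ker_dim f A; have := limg_ker_dim f T; rewrite kT.
have fTE : (f @: T = f @: A :&: B)%VS.
  apply/vspaceP => w; rewrite memv_cap; apply/memv_imgP/andP.
    case=> v; rewrite memv_cap -memv_preim => /andP[vA fvB ->].
    by rewrite memv_img.
  case=> /memv_imgP[v vA ->] fvB.
  by exists v; rewrite // memv_cap vA -memv_preim.
rewrite fTE; have := dimv_sum_cap (f @: A)%VS B.
have := dimvS (_ : (f @: A + B <= Z)%VS); rewrite subv_add sfAZ sBZ => /(_ isT).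
have := dimvS sBZ; lia.
Qed.

(* The middle term of an exact sequence ZA/BA -> ZB/BB -> ZC/BC.              *)
Lemma dim_middle_exact f g ZA BA ZB BB ZC BC :
  (BA <= ZA)%VS -> (BB <= ZB)%VS -> (BC <= ZC)%VS ->
  (f @: BA <= BB)%VS -> (g @: ZB <= ZC)%VS ->
  (forall z, z \in ZB -> g z \in BC -> exists2 a, a \in ZA & z - f a \in BB) ->
  (\dim ZB - \dim BB <= (\dim ZA - \dim BA) + (\dim ZC - \dim BC))%N.
Proof.
move=> sA sB sC fBA gZB ex; set T := (ZB :&: (g @^-1: BC))%VS.
have := dim_quotient_preim sC gZB; rewrite -/T => dT.
have sT : (T <= f @: ZA + BB)%VS.
  apply/subvP => z; rewrite memv_cap -memv_preim => /andP[zZ gz].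
  have [a aZ zB] := ex z zZ gz.
  by rewrite -[z](subrK (f a)) addrC memv_add ?memv_img.
have dsum := dimv_sum_cap (f @: ZA)%VS BB.
have dBA : (\dim (f @: BA) <= \dim (f @: ZA :&: BB))%N.
  by rewrite dimvS // subv_cap limgS.
have := dim_quotient_img f sA; have := dimvS sT; have := dimvS (limgS f sA).
lia.
Qed.

End ThreeTermExactness.

(** * Complexes graded by subsets of [n] whose differential only enlarges the subset *)

Section FilteredComplex.
Variables (K : fieldType) (n : nat) (V : vectType K).
Variables (pi : int -> {set 'I_n} -> 'End(V)) (D : int -> 'End(V)).
Implicit Types (m : int) (B U W : {set 'I_n}) (P Q : {set {set 'I_n}}).

(* pi m B is the projection of V to a summand of cohomological degree m, D m  *)
(* is the differential on degree m; it is only required to increase B.        *)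
Record filtered_complex : Prop := {
  filt_id : forall m B v, pi m B (pi m B v) = pi m B v;
  filt_orth : forall m B B' v, B != B' -> pi m B (pi m B' v) = 0;
  filt_diff : forall m B v, D m (pi m B v) =
    \sum_(B' : {set 'I_n} | B \subset B') pi (m + 1) B' (D m (pi m B v));
  filt_diffK : forall m v, D (m + 1) (D m v) = 0
}.

Definition prp m P : 'End(V) := \sum_(B in P) pi m B.
Definition cochain m P : {vspace V} := limg (prp m P).
Definition cdiff m P : 'End(V) := (prp (m + 1) P \o D m)%VF.
Definition cocycles m P : {vspace V} := (cochain m P :&: lker (cdiff m P))%VS.
Definition cobounds m P : {vspace V} := (cdiff m P @: cochain m P)%VS.
(* the dimension of H^m of the subquotient spanned by the pi _ B, B in P      *)
Definition hdim m P : nat := (\dim (cocycles m P) - \dim (cobounds (m - 1) P))%N.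

(** A convex family is the difference of two up-closed families, so that its summands span a
    subquotient complex. *)
Definition convex P :=
  forall B B' B'', B \in P -> B'' \in P -> B \subset B' -> B' \subset B'' -> B' \in P.
Definition intv U W : {set {set 'I_n}} :=
  [set B : {set 'I_n} | (U \subset B) && (B \subset W)].

Lemma convex_intv U W : convex (intv U W).
Proof.
move=> B B' B''; rewrite !inE => /andP[UB _] /andP[_ BW] BB' BB''.
by rewrite (subset_trans UB BB') (subset_trans BB'' BW).
Qed.

Hypothesis fc : filtered_complex.

Lemma prpE m P v : prp m P v = \sum_(B in P) pi m B v.
Proof. by rewrite sum_lfunE. Qed.

Lemma pi_prp m P B v : pi m B (prp m P v) = if B \in P then pi m B v else 0.
Proof.
rewrite prpE linear_sum /=; case: ifPn => [BP|nBP].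
  rewrite (bigD1 B) //= (filt_id fc) big1 ?addr0 // => B' /andP[_ ne].
  by rewrite (filt_orth fc) // eq_sym.
by apply: big1 => B' B'P; rewrite (filt_orth fc) //; apply: contraNneq nBP => ->.
Qed.

Lemma prp_prp m P Q v : prp m P (prp m Q v) = prp m (P :&: Q) v.
Proof.
rewrite prpE [RHS]prpE (big_setID Q) /= [X in _ + X]big1 ?addr0.
  by apply: eq_bigr => B; rewrite inE pi_prp => /andP[_ ->].
by move=> B; rewrite inE pi_prp => /andP[/negbTE->].
Qed.

Lemma prp_id m P v : prp m P (prp m P v) = prp m P v.
Proof. by rewrite prp_prp setIid. Qed.

Lemma prp0 m v : prp m set0 v = 0.
Proof. by rewrite prpE big_set0. Qed.

Lemma prpU m P Q v : [disjoint P & Q] -> prp m (P :|: Q) v = prp m P v + prp m Q v.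
Proof.
by move=> dPQ; rewrite !prpE -bigU //=; apply: eq_bigl => B; rewrite !inE.
Qed.

Lemma cochainP m P v : reflect (prp m P v = v) (v \in cochain m P).
Proof.
apply: (iffP idP) => [/memv_imgP[u _ ->]|<-]; first exact: prp_id.
by rewrite memv_img ?memvf.
Qed.

Lemma mem_cochain m P v : prp m P v \in cochain m P.
Proof. exact/cochainP/prp_id. Qed.

Lemma prp_sub m P Q v : P \subset Q -> v \in cochain m P -> prp m Q v = v.
Proof. by move=> sPQ /cochainP<-; rewrite prp_prp (setIidPr sPQ). Qed.

Lemma prp_disj m P Q v : [disjoint P & Q] -> v \in cochain m P -> prp m Q v = 0.
Proof.
by rewrite -setI_eq0 => /eqP dPQ /cochainP<-; rewrite prp_prp setIC dPQ prp0.
Qed.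

Lemma diff_prp m P v : v \in cochain m P ->
  D m v = prp (m + 1) setT (D m v).
Proof.
move=> /cochainP<-; rewrite prpE linear_sum linear_sum /=.
apply: eq_bigr => B _; rewrite (filt_diff fc) [RHS]linear_sum /=.
apply: eq_bigr => B' _; rewrite prpE (bigD1 B') ?inE //= (filt_id fc).
by rewrite big1 ?addr0 // => B'' /andP[_ ne]; rewrite (filt_orth fc).
Qed.

(** The differential reaches only supersets of members of [P], and [Q] contains none of these. *)
Lemma prp_diff_eq0 m P Q v : v \in cochain m P ->
    {in P & Q, forall B B', ~~ (B \subset B')} -> prp (m + 1) Q (D m v) = 0.
Proof.
move=> /cochainP<- PQ; rewrite [prp m P v]prpE !linear_sum big1 //= => B BP.
rewrite (filt_diff fc) linear_sum big1 //= => B' sBB'.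
rewrite prpE big1 // => B'' B''Q; rewrite (filt_orth fc) //.
by apply: contraTneq sBB' => <-; apply: PQ.
Qed.

(* In P, the square of the differential only misses the paths that leave P and *)
(* come back to it, and there is none by convexity.                            *)
Lemma cdiffK m P v : convex P -> v \in cochain m P ->
  cdiff (m + 1) P (cdiff m P v) = 0.
Proof.
move=> cP vP; rewrite !comp_lfunE.
have split_diff : D m v = prp (m + 1) P (D m v) + prp (m + 1) (~: P) (D m v).
  rewrite -prpU ?setUCr; first exact: diff_prp vP.
  by rewrite -setI_eq0 setICr.
have -> : prp (m + 1) P (D m v) = D m v - prp (m + 1) (~: P) (D m v).
  by rewrite {2}split_diff addrK.
rewrite linearB /= (filt_diffK fc) sub0r linearN /=.
apply/eqP; rewrite oppr_eq0; apply/eqP.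
move/cochainP: vP => <-; rewrite [prp m P v]prpE !linear_sum big1 //= => B BP.
rewrite [prp _ (~: P) _]prpE !linear_sum big1 //= => B'; rewrite inE => nB'P.
rewrite [D (m + 1) _](filt_diff fc) linear_sum big_mkcond big1 //= => B'' _.
case: ifP => // sB'B''.
have [sBB'|nsBB'] := boolP (B \subset B'); last first.
  suff -> : pi (m + 1) B' (D m (pi m B v)) = 0 by rewrite !linear0.
  rewrite (filt_diff fc) linear_sum big1 //= => C sBC.
  by rewrite (filt_orth fc) //; apply: contraNneq nsBB' => ->.
have nB''P : B'' \notin P by apply: contra nB'P => B''P; apply: cP BP B''P sBB' sB'B''.
rewrite prpE big1 // => C CP.
by rewrite (filt_orth fc) //; apply: contraNneq nB''P => <-.
Qed.

Lemma cocyclesP m P v :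
  reflect (v \in cochain m P /\ cdiff m P v = 0) (v \in cocycles m P).
Proof.
rewrite memv_cap memv_ker.
by apply: (iffP andP) => -[-> /eqP].
Qed.

Lemma coboundsP m P v :
  reflect (exists2 w, w \in cochain m P & v = cdiff m P w) (v \in cobounds m P).
Proof. exact: memv_imgP. Qed.

Lemma cdiff_cochain m P v : cdiff m P v \in cochain (m + 1) P.
Proof. by rewrite comp_lfunE mem_cochain. Qed.

Lemma cobounds_sub m P : convex P -> (cobounds (m - 1) P <= cocycles m P)%VS.
Proof.
move=> cP; apply/subvP => _ /coboundsP[w wP ->]; apply/cocyclesP.
have := cdiffK cP wP; have := cdiff_cochain (m - 1) P w.
by rewrite !subrK.
Qed.

(** Rank-nullity removes the kernel. Duality can then be checked on dimensions of cochains and on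
    ranks of differentials, which transposition preserves. *)
Lemma hdimE m P : hdim m P =
  (\dim (cochain m P) - \dim (cobounds m P) - \dim (cobounds (m - 1) P))%N.
Proof.
rewrite /hdim; congr (_ - _)%N; have := limg_ker_dim (cdiff m P) (cochain m P).
by rewrite -/(cobounds m P) -/(cocycles m P); lia.
Qed.

(** * The long exact sequence of an up-closed subfamily [P1] of [P] with complement [P2] *)

Section Split.
Variables (P P1 P2 : {set {set 'I_n}}).
Hypotheses (cP : convex P) (cP1 : convex P1) (cP2 : convex P2).
Hypotheses (PE : P = P1 :|: P2) (dP : [disjoint P1 & P2]).
Hypothesis upP1 : {in P1 & P2, forall B B', ~~ (B \subset B')}.

Let sP1 : P1 \subset P. Proof. by rewrite PE subsetUl. Qed.
Let sP2 : P2 \subset P. Proof. by rewrite PE subsetUr. Qed.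

Let cochain1 m v : v \in cochain m P1 -> v \in cochain m P.
Proof. by move=> vP; apply/cochainP; apply: prp_sub vP. Qed.
Let cochain2 m v : v \in cochain m P2 -> v \in cochain m P.
Proof. by move=> vP; apply/cochainP; apply: prp_sub vP. Qed.

Let cdiffE m v : cdiff m P v = cdiff m P1 v + cdiff m P2 v.
Proof. by rewrite !comp_lfunE PE prpU. Qed.

Let cdiff21 m v : v \in cochain m P1 -> cdiff m P2 v = 0.
Proof. by move=> vP1; rewrite comp_lfunE (prp_diff_eq0 vP1). Qed.

Let cochain_split m v : v \in cochain m P -> v = prp m P1 v + prp m P2 v.
Proof. by move=> /cochainP {1}<-; rewrite PE prpU. Qed.

(** This is the [P1] component of the vanishing square of the differential. It says that
    [cdiff m P1], which induces the connecting map on [P2], anticommutes with the differentials. *)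
Let cdiff1_cdiff2 m v : v \in cochain m P2 ->
  cdiff (m + 1) P1 (cdiff m P1 v) + cdiff (m + 1) P1 (cdiff m P2 v) = 0.
Proof.
move=> vP2; rewrite -linearD -cdiffE /=.
have := congr1 (prp (m + 1 + 1) P1) (cdiffK cP (cochain2 vP2)).
rewrite cdiffE linear0 linearD /= (prp_sub (subxx _) (cdiff_cochain _ _ _)).
by rewrite (prp_disj _ (cdiff_cochain _ _ _)) ?addr0 // disjoint_sym.
Qed.

(** Exactness of H^m(P) -> H^m(P2) -> H^(m+1)(P1) at the middle term; the second map is the
    connecting map. *)
Lemma hdim_quotient_le m : (hdim m P2 <= hdim m P + hdim (m + 1) P1)%N.
Proof.
apply: (@dim_middle_exact _ _ (prp m P2) (cdiff m P1)); try exact: cobounds_sub.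
- apply/subvP => _ /memv_imgP[_ /coboundsP[w wP ->] ->].
  apply/coboundsP; exists (prp (m - 1) P2 w); first exact: mem_cochain.
  have inP Q : cdiff (m - 1) Q w \in cochain m Q.
    by have := cdiff_cochain (m - 1) Q w; rewrite subrK.
  rewrite cdiffE linearD /= (prp_disj dP (inP _)) add0r (prp_sub _ (inP _)) //.
  by rewrite {1}(cochain_split wP) linearD /= (cdiff21 (mem_cochain _ _ _)) add0r.
- apply/subvP => _ /memv_imgP[v /cocyclesP[vP2 dv] ->].
  apply/cocyclesP; split; first exact: cdiff_cochain.
  by have := cdiff1_cdiff2 vP2; rewrite dv linear0 addr0.
move=> z /cocyclesP[zP2 dz]; rewrite addrK => /coboundsP[w wP1 zw].
(* A cocycle [z] of the quotient whose connecting image is the coboundary of [w] lifts to a cocycle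
   of [P] after subtracting [w]. *)
exists (z - w).
  apply/cocyclesP; split; first by rewrite memvB //; [apply: cochain2|apply: cochain1].
  by rewrite linearB /= !cdiffE dz (cdiff21 wP1) !addr0 zw subrr.
by rewrite linearB /= (prp_disj dP wP1) subr0 (prp_sub _ zP2) // subrr mem0v.
Qed.

(** Exactness of H^m(P2) -> H^(m+1)(P1) -> H^(m+1)(P) at the middle term; the first map is the
    connecting map. *)
Lemma hdim_sub_le m : (hdim (m + 1) P1 <= hdim m P2 + hdim (m + 1) P)%N.
Proof.
apply: (@dim_middle_exact _ _ (cdiff m P1) \1%VF); try exact: cobounds_sub.
- apply/subvP => _ /memv_imgP[_ /coboundsP[w wP2 ->] ->].
  (* The sign comes from the anticommutation in [cdiff1_cdiff2]. *)
  rewrite addrK; apply/coboundsP; exists (- cdiff (m - 1) P1 w).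
    by rewrite memvN; have := cdiff_cochain (m - 1) P1 w; rewrite subrK.
  have := cdiff1_cdiff2 wP2; rewrite subrK linearN /= => /eqP.
  by rewrite addrC addr_eq0 => /eqP.
- apply/subvP => _ /memv_imgP[v /cocyclesP[vP1 dv] ->].
  rewrite id_lfunE; apply/cocyclesP; split; first exact: cochain1.
  by rewrite cdiffE dv add0r cdiff21.
move=> z /cocyclesP[zP1 dz]; rewrite id_lfunE addrK => /coboundsP[w wP zw].
have zE : z = cdiff m P1 w.
  rewrite -(prp_sub (subxx _) zP1) zw cdiffE linearD /=.
  rewrite (prp_sub (subxx _) (cdiff_cochain _ _ _)).
  rewrite (prp_disj _ (cdiff_cochain _ _ _)) ?addr0 // disjoint_sym //.
have d2w : cdiff m P2 w = 0.
  have := zw; rewrite cdiffE {1}zE => /eqP; rewrite -subr_eq0 opprD addNKr.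
  by rewrite oppr_eq0 => /eqP.
(* If [z] bounds [w] in [P], the [P2] component of [w] is a cocycle, and its connecting image
   differs from [z] by the coboundary of the [P1] component. *)
exists (prp m P2 w).
  apply/cocyclesP; split; first exact: mem_cochain.
  by move: d2w; rewrite {1}(cochain_split wP) linearD /= cdiff21 ?mem_cochain ?add0r.
apply/coboundsP; exists (prp m P1 w); first exact: mem_cochain.
by rewrite zE -linearB /= {1}(cochain_split wP) addrK.
Qed.

End Split.

(** The members of the interval that contain [l] are up-closed in it, and those that avoid [l] form
    the quotient. *)
Lemma hdim_intv_le (U W : {set 'I_n}) (l : 'I_n) m : l \in W -> l \notin U ->
  (hdim m (intv U (W :\ l)) <= hdim m (intv U W) + hdim (m + 1) (intv (l |: U) W))%N
  /\ (hdim (m + 1) (intv (l |: U) W) <=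
      hdim m (intv U (W :\ l)) + hdim (m + 1) (intv U W))%N.
Proof.
move=> lW lU; have UE : intv U W = intv (l |: U) W :|: intv U (W :\ l).
  apply/setP => B; rewrite !inE subUset sub1set subsetD1.
  by case: (l \in B); rewrite ?andbF ?andbT ?orbF.
have dUW : [disjoint intv (l |: U) W & intv U (W :\ l)].
  rewrite -setI_eq0; apply/eqP/setP => B; rewrite !inE subUset sub1set subsetD1.
  by case: (l \in B); rewrite ?andbF.
have up : {in intv (l |: U) W & intv U (W :\ l), forall B B', ~~ (B \subset B')}.
  move=> B B'; rewrite !inE subUset sub1set subsetD1.
  move=> /andP[/andP[lB _] _] /andP[_ /andP[_ lB']].
  by apply: contra lB' => /subsetP; apply.
by split; [apply: hdim_quotient_le UE dUW up _|apply: hdim_sub_le UE dUW up _];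
  apply: convex_intv.
Qed.

(** * Propagation of vanishing between intervals *)

Section Strip.
Variables (F : {set 'I_n}) (i : int).

(** The window of degrees is adapted to the exact sequences: adding an element to [U] raises its
    lower end by 1, adding one to [W] raises its upper end by 1, and the connecting map raises
    degrees by 1. *)
Definition strip_vanish U W := forall j,
  i - n%:Z + #|F|%:Z + #|U|%:Z <= j -> j <= i - n%:Z + #|W|%:Z ->
  hdim j (intv U W) = 0%N.

(** Induction on the complement of [W]. For [l] outside [W], the complex of [(U, W)] is a quotient
    of that of [(U, l |: W)] with kernel that of [(l |: U, l |: W)], and both have a smaller
    complement. *)
Lemma strip_vanish_top :
    (forall U, [disjoint U & F] -> U :|: F \proper setT -> strip_vanish U setT) ->
  forall U W, [disjoint U & F] -> U :|: F \proper W -> strip_vanish U W.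
Proof.
move=> vanT U W; have [k] := ubnP #|~: W|.
elim: k U W => // k IHk U W ltW dU pW; have [->|] := eqVneq W setT.
  by apply: vanT => //; apply: (proper_sub_trans pW); apply: subsetT.
rewrite -subTset => /subsetPn[l _ lW].
have lUF : l \notin U :|: F by apply: contra lW; apply/subsetP/proper_sub.
have [lU lF] : l \notin U /\ l \notin F by move: lUF; rewrite inE negb_or => /andP.
have pW' : U :|: F \proper l |: W by apply: (proper_sub_trans pW); apply: subsetUr.
have cW' : #|l |: W| = #|W|.+1 by rewrite cardsU1 lW.
have cU' : #|l |: U| = #|U|.+1 by rewrite cardsU1 lU.
have ltW' : (#|~: (l |: W)| < k)%N.
  have := cardsC W; have := cardsC (l |: W); lia.
move=> j lej jle.
have vj : hdim j (intv U (l |: W)) = 0%N by apply: IHk ltW' dU pW' _ _ _ => //; lia.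
have vj1 : hdim (j + 1) (intv (l |: U) (l |: W)) = 0%N.
  apply: (IHk (l |: U)) => //; [| |lia|lia].
    by rewrite disjointsUl disjoints1 lF.
  rewrite -setUA; apply/properP; split; first by rewrite setUS // proper_sub.
  case/properP: pW => _ [x xW xUF]; exists x; first by rewrite inE xW orbT.
  by rewrite in_setU1 negb_or xUF andbT; apply: contraNneq lW => <-.
have [+ _] := hdim_intv_le j (setU11 l W) lU.
by rewrite setU1K // vj vj1 addn0 leqn0 => /eqP.
Qed.

(** The mirror induction, on the size of [U]. For [l] in [U], the complex of [(U, W)] is the kernel
    of the map from that of [(U :\ l, W)] to that of [(U :\ l, W :\ l)]. *)
Lemma strip_vanish_bot :
    (forall W, F \proper W -> strip_vanish set0 W) ->
  forall U W, [disjoint U & F] -> U :|: F \proper W -> strip_vanish U W.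
Proof.
move=> van0 U W; have [k] := ubnP #|U|.
elim: k U W => // k IHk U W ltU dU pW; have [U0|] := eqVneq U set0.
  by rewrite U0; apply: van0; move: pW; rewrite U0 set0U.
case/set0Pn => l lU; have lF : l \notin F by rewrite (disjointFr dU).
have lW : l \in W by apply: (subsetP (proper_sub pW)); rewrite inE lU.
pose U' := U :\ l; have lU' : l \notin U' by rewrite !inE eqxx.
have UE : U = l |: U' by rewrite setD1K.
have cU' : #|U| = #|U'|.+1 by rewrite (cardsD1 l) lU.
have cW' : #|W| = #|W :\ l|.+1 by rewrite (cardsD1 l) lW.
have dU' : [disjoint U' & F] by apply: disjointWl dU; apply: subsetDl.
have sU' : U' :|: F \subset U :|: F by rewrite setSU ?subsetDl.
have ltU' : (#|U'| < k)%N by rewrite cU' in ltU.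
move=> j lej jle.
have vj : hdim j (intv U' W) = 0%N.
  by apply: IHk ltU' dU' _ _ _ _; [apply: sub_proper_trans pW|lia|lia].
have vj1 : hdim (j - 1) (intv U' (W :\ l)) = 0%N.
  apply: IHk ltU' dU' _ _ _ _; [|lia|lia].
  case/properP: pW => /subsetP sUW [x xW xUF].
  apply/properP; split.
    apply/subsetP => y yU; rewrite !inE sUW ?(subsetP sU') // andbT.
    apply: contraTneq yU => ->; rewrite inE negb_or lU' //.
  exists x; last by apply: contra xUF; apply/subsetP.
  by rewrite !inE xW andbT; apply: contraNneq xUF => ->; rewrite inE lU.
have [_] := hdim_intv_le (j - 1) lW lU'.
by rewrite subrK -UE vj vj1 leqn0 => /eqP.
Qed.

(** Removing [l] from [U], the window of the pair [(U :\ l, U :|: F)] consists of exactly the two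
    degrees m and m + 1. The middle complex has no cohomology there, so the connecting map is an
    isomorphism. *)
Lemma hdim_strip_edge U :
    (forall U W, [disjoint U & F] -> U :|: F \proper W -> strip_vanish U W) ->
    [disjoint U & F] ->
  hdim (i - n%:Z + #|F|%:Z + #|U|%:Z) (intv U (U :|: F)) =
  hdim (i - n%:Z + #|F|%:Z) (intv set0 F).
Proof.
move=> van; have [k] := ubnP #|U|; elim: k U => // k IHk U ltU dU.
have [->|] := eqVneq U set0; first by rewrite cards0 addr0 set0U.
case/set0Pn => l lU; have lF : l \notin F by rewrite (disjointFr dU).
pose U' := U :\ l; have lU' : l \notin U' by rewrite !inE eqxx.
have UE : U = l |: U' by rewrite setD1K.
have cU' : #|U| = #|U'|.+1 by rewrite (cardsD1 l) lU.
have dU' : [disjoint U' & F] by apply: disjointWl dU; apply: subsetDl.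
have lUF : l \notin U' :|: F by rewrite inE negb_or lU'.
have UFE : U :|: F = l |: (U' :|: F) by rewrite UE setUA.
have cUF : #|U :|: F| = (#|U'| + #|F|).+1.
  rewrite UFE cardsU1 lUF cardsU; move: dU'; rewrite -setI_eq0 => /eqP->.
  by rewrite cards0 subn0.
rewrite -(IHk U') //; last by rewrite cU' in ltU.
set m := i - n%:Z + #|F|%:Z + #|U'|%:Z.
have -> : i - n%:Z + #|F|%:Z + #|U|%:Z = m + 1 by rewrite /m; lia.
have pU : U' :|: F \proper U :|: F by rewrite UFE properUr // sub1set.
have vm : hdim m (intv U' (U :|: F)) = 0%N by apply: (van U') => //; rewrite /m; lia.
have vm1 : hdim (m + 1) (intv U' (U :|: F)) = 0%N.
  by apply: (van U') => //; rewrite /m; lia.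
have lUF' : l \in U :|: F by rewrite inE lU.
have [] := hdim_intv_le m lUF' lU'; rewrite vm vm1 -UE.
have -> : (U :|: F) :\ l = U' :|: F by rewrite UFE setU1K.
by rewrite add0n addn0 => le1 le2; apply/eqP; rewrite eqn_leq le1 le2.
Qed.

End Strip.
End FilteredComplex.

(** * Prime ideals generated by variables *)

Section MonomialPrimes.
Variables (K : fieldType) (n : nat).
Local Notation S := {mpoly K[n]}.
Implicit Types (F G : {set 'I_n}) (s t : S) (c : 'X_{1..n}).

Lemma PidealD F s t : Pideal F s -> Pideal F t -> Pideal F (s + t).
Proof.
move=> [h ->] [h' ->]; exists (fun l => h l + h' l).
by rewrite -big_split; apply: eq_bigr => l _; rewrite mulrDl.
Qed.

Lemma PidealM F s t : Pideal F t -> Pideal F (s * t).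
Proof.
move=> [h ->]; exists (fun l => s * h l).
by rewrite mulr_sumr; apply: eq_bigr => l _; rewrite mulrA.
Qed.

Lemma Pideal0 F : Pideal F (0 : S).
Proof. by exists (fun=> 0); rewrite big1 // => l _; rewrite mul0r. Qed.

Lemma Pideal_sum F (I : eqType) (r : seq I) (f : I -> S) :
  {in r, forall k, Pideal F (f k)} -> Pideal F (\sum_(k <- r) f k).
Proof.
move=> fP; rewrite big_seq; apply: big_ind => //; first exact: Pideal0.
exact: PidealD.
Qed.

Lemma Pideal_X F l : l \notin F -> Pideal F ('X_l : S).
Proof.
move=> lF; exists (fun k => (k == l)%:R).
rewrite (bigD1 l) //= eqxx mul1r big1 ?addr0 // => k /andP[_ /negbTE->].
by rewrite mul0r.
Qed.

Lemma Pideal_monomial F c l : l \notin F -> c l != 0%N -> Pideal F ('X_[c] : S).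
Proof.
move=> lF cl; have -> : c = (c - U_(l) + U_(l))%MM.
  by apply/mnmP => k; rewrite mnmDE mnmBE mnm1E; have [<-|_] := eqVneq l k; lia.
by rewrite mpolyXD; apply/PidealM/Pideal_X.
Qed.

Lemma Pideal_msupp F s :
  {in msupp s, forall c, exists2 l, l \notin F & c l != 0%N} -> Pideal F s.
Proof.
move=> sF; rewrite [s]mpolyE; apply: Pideal_sum => c /sF[l lF cl].
by rewrite -mul_mpolyC; apply: PidealM; apply: Pideal_monomial cl.
Qed.

Lemma Pideal_mono F G s : F \subset G -> Pideal G s -> Pideal F s.
Proof.
move=> FG [h ->]; rewrite big_mkcond -big_filter; apply: Pideal_sum => l _.
case: ifP => lG; last exact: Pideal0.
by apply/PidealM/Pideal_X; apply: contra lG; apply: (subsetP FG).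
Qed.

(* The projection of S to S/P_F = K[x_l | l in F]                             *)
Definition restr F : S -> S := mmap (@mpolyC n K) (fun l => if l \in F then 'X_l else 0).
HB.instance Definition _ F := GRing.RMorphism.on (restr F).

Lemma restr_X F l : restr F 'X_l = if l \in F then 'X_l else 0.
Proof. by rewrite /restr mmapX mmap1U. Qed.

Lemma restr_Pideal F s : Pideal F s -> restr F s = 0.
Proof.
case=> h ->; rewrite rmorph_sum big1 //= => l lF.
by rewrite rmorphM /= restr_X (negbTE lF) mulr0.
Qed.

(** Monomials that involve a variable outside [F] are killed by [restr F], and the others are fixed.
    Hence the kernel of [restr F] is contained in P_F. *)
Lemma Pideal_subr_restr F s : Pideal F (s - restr F s).
Proof.
rewrite {2}[s]mpolyE {1}[s]mpolyE rmorph_sum -sumrB.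
apply: Pideal_sum => c _; rewrite -mul_mpolyC rmorphM /=.
have -> : restr F (s@_c)%:MP = (s@_c)%:MP by rewrite /restr mmapC.
rewrite -mulrBr; apply: PidealM; rewrite /restr mmapX /mmap1.
have [/existsP[l /andP[lF cl]]|/existsPn cF] :=
  boolP [exists l, (l \notin F) && (c l != 0%N)].
  rewrite [X in _ - X](bigD1 l) //= (negbTE lF) expr0n (negbTE cl) mul0r subr0.
  exact: Pideal_monomial cl.
rewrite mpolyXE_id [X in X - _](eq_bigr (fun l =>
  (if l \in F then 'X_l else 0) ^+ c l)) ?subrr => [|l _]; first exact: Pideal0.
by have := cF l; case: (l \in F) => //=; rewrite negbK => /eqP->; rewrite !expr0.
Qed.

Lemma restr_eq0 F s : restr F s = 0 -> Pideal F s.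
Proof. by have := Pideal_subr_restr F s => + s0; rewrite s0 subr0. Qed.

(** P_F is the kernel of the endomorphism [restr F] of the domain S. *)
Lemma Pideal_prime F : prime_ideal (@Pideal K n F).
Proof.
split; first exact: Pideal0; first exact: PidealD; first exact: PidealM.
  by move/restr_Pideal/eqP; rewrite rmorph1 oner_eq0.
move=> s t /restr_Pideal/eqP; rewrite rmorphM mulf_eq0.
by case/orP=> /eqP; [left|right]; apply: restr_eq0.
Qed.

Lemma Pideal_sub F G : (forall s, @Pideal K n F s -> Pideal G s) -> G \subset F.
Proof.
move=> sFG; apply/subsetP => l lG; apply/negPn/negP => /Pideal_X/sFG/restr_Pideal.
rewrite restr_X lG => /(congr1 (mcoeff U_(l))) /eqP.
by rewrite mcoeffX mcoeff0 eqxx oner_eq0.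
Qed.

Lemma prime_ideal_prod (Q : S -> Prop) (I : finType) (A : {pred I}) (f : I -> S) :
  prime_ideal Q -> Q (\prod_(k in A) f k) -> exists2 k, k \in A & Q (f k).
Proof.
move=> [_ _ _ nQ1 Qp]; rewrite -big_enum => Qf.
suff [k] : exists2 k, k \in enum A & Q (f k) by rewrite mem_enum; exists k.
elim: (enum A) Qf => [|k r IHr]; first by rewrite big_nil.
rewrite big_cons => /Qp[Qk|/IHr[k' k'r Qk']]; first by exists k; rewrite ?mem_head.
by exists k'; rewrite // inE k'r orbT.
Qed.

End MonomialPrimes.

(** * Linear projections onto the parts of a graded space of finite dimension *)

Section GradingProjections.
Variables (K : fieldType) (V : vectType K) (I : eqType) (h : I -> V -> Prop).

Record grading_proj (pr : I -> 'End(V)) (s : seq I) : Prop := {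
  gproj_mem : forall p v, h p (pr p v);
  gproj_id : forall p v, h p v -> pr p v = v;
  gproj_neq : forall p q v, h q v -> p != q -> pr p v = 0;
  gproj_sum : forall v, v = \sum_(p <- s) pr p v
}.

Hypothesis gr : is_grading h.

Lemma gradingN p v : h p v -> h p (- v).
Proof. by move=> hv; rewrite -sub0r; apply: (gradingB gr) => //; apply: grading0. Qed.

Lemma gradingD p u v : h p u -> h p v -> h p (u + v).
Proof. by move=> hu hv; rewrite -[v]opprK; apply: (gradingB gr) => //; apply: gradingN. Qed.

Lemma grading_sum p (J : eqType) (r : seq J) (P : pred J) (f : J -> V) :
  {in r, forall k, P k -> h p (f k)} -> h p (\sum_(k <- r | P k) f k).
Proof.
move=> hf; rewrite big_seq_cond; apply: big_ind; first exact: grading0.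
  exact: gradingD.
by move=> k /andP[]; apply: hf.
Qed.

(** A normal form of [grading_span], which allows repeated degrees and values outside the list. *)
Lemma grading_decomp v : exists fs : (I -> V) * seq I,
  [/\ uniq fs.2, forall p, h p (fs.1 p), {in predC (mem fs.2), forall p, fs.1 p = 0}
    & v = \sum_(p <- fs.2) fs.1 p].
Proof.
have [s [f [hf ->]]] := grading_span gr v.
(* A degree that occurs k times in [s] contributes [f p] k times; outside [s] the multiplicity 0
   gives 0. *)
exists (fun p => f p *+ count_mem p s, undup s); split=> /= [|p|p|].
- exact: undup_uniq.
- elim: (count _ s) => [|k IHk]; first exact: grading0.
  by rewrite mulrS; apply: gradingD.
- by rewrite inE /= mem_undup => /count_memPn->.
rewrite -big_undup_iterop_count; apply: eq_bigr => p _.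
by case: (count _ s) => // k; rewrite -Monoid.iteropE mulrS -iterSr.
Qed.

Hypothesis hZ : forall p k v, h p v -> h p (k *: v).

(** Decompositions are chosen for the vectors of a basis and extended linearly. Directness shows
    that the resulting maps are the projections. *)
Lemma grading_proj_exists : exists pr s, grading_proj pr s.
Proof.
pose X := vbasis {: V}.
have [fs fsP] := fin_all_exists (fun i : 'I_(\dim {: V}) => grading_decomp X`_i).
pose s := undup (flatten [seq (fs i).2 | i : 'I_(\dim {: V})]).
pose g p v := \sum_i coord X i v *: (fs i).1 p.
have lin p : linear (g p).
  move=> k u v; rewrite /g scaler_sumr -big_split; apply: eq_bigr => i _ /=.
  by rewrite linearP scalerDl scalerA.
pose gl p : {linear V -> V} :=
  HB.pack (g p) (GRing.isLinear.Build K V V *:%R (g p) (lin p)).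
pose pr p : 'End(V) := linfun (gl p).
have prE p v : pr p v = g p v by rewrite lfunE.
have hpr p v : h p (pr p v).
  rewrite prE; apply: grading_sum => i _ _; apply: hZ.
  by have [_ hf _ _] := fsP i; apply: hf.
have prout p v : p \notin s -> pr p v = 0.
  rewrite mem_undup => ps; rewrite prE; apply: big1 => i _.
  have [_ _ f0 _] := fsP i; rewrite f0 ?scaler0 // inE.
  apply: contra ps => pi; apply/flattenP; exists (fs i).2 => //.
  exact: image_f.
have sumE v : v = \sum_(p <- s) pr p v.
  rewrite {1}(coord_vbasis (memvf v)) (eq_bigr _ (fun p _ => prE p v)).
  rewrite exchange_big; apply: eq_bigr => i _ /=; rewrite -scaler_sumr.
  congr (_ *: _); have [us _ f0 fE] := fsP i; rewrite {1}fE.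
  rewrite [RHS](bigID (mem (fs i).2)) /= [X in _ + X]big1 ?addr0 => [|p np].
    rewrite -[RHS]big_filter; apply: perm_big; apply: uniq_perm => //.
      by rewrite filter_uniq ?undup_uniq.
    move=> p; rewrite mem_filter /=; case: (boolP (p \in _)) => //= pi.
    rewrite mem_undup; apply/esym/flattenP; exists (fs i).2 => //.
    exact: image_f.
  by rewrite f0.
have main p q v : h q v -> pr p v = if p == q then v else 0.
  move=> hv; have [pqs|] := boolP (p \in undup (q :: s)); last first.
    rewrite mem_undup inE negb_or => /andP[/negbTE-> ps]; exact: prout.
  (* The decomposition given by [pr] and the one with the single term [v] in degree [q] have the
     same sum, hence the same terms. *)
  apply/eqP; rewrite -subr_eq0; apply/eqP; move: p pqs.
  apply: (grading_direct gr); first exact: undup_uniq.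
    move=> p; apply: (gradingB gr) => //; case: eqP => [->//|_]; exact: grading0.
  have qs : q \in undup (q :: s) by rewrite mem_undup mem_head.
  rewrite sumrB [X in _ - X](bigD1_seq q) ?undup_uniq //= eqxx.
  rewrite [X in _ - (_ + X)]big1 ?addr0 => [|p /negbTE-> //].
  suff -> : \sum_(p <- undup (q :: s)) pr p v = v by rewrite subrr.
  rewrite {2}[v]sumE /=; case: ifP => qs'; first by rewrite undup_id ?undup_uniq.
  by rewrite big_cons prout ?qs' // add0r undup_id ?undup_uniq.
exists pr, s; split=> // [p v hv|p q v hv pq]; rewrite (main _ _ _ hv).
  by rewrite eqxx.
by rewrite (negbTE pq).
Qed.

End GradingProjections.

(** * Coefficients of polynomial vectors and their value at x = 1 *)

Section PolynomialVectors.
Variables (K : fieldType) (n : nat) (V W : vectType K).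
Local Notation S := {mpoly K[n]}.
Implicit Types (c k : 'X_{1..n}) (p : S) (f : 'Hom(V, W)).

Lemma r2v_mul_f2mx (f : 'Hom(V, W)) x : r2v (x *m f2mx f) = f (r2v x).
Proof. by rewrite unlock /= r2vK. Qed.

Definition ev1 (w : 'rV[S]_(dim V)) : V := r2v (map_mx (meval (fun=> 1)) w).

Fact ev1_is_additive : zmod_morphism ev1.
Proof. by move=> w w'; rewrite /ev1 raddfB linearB. Qed.
HB.instance Definition _ := GRing.isZmodMorphism.Build _ _ ev1 ev1_is_additive.

Lemma ev1Z p w : ev1 (p *: w) = p.@[fun=> 1] *: ev1 w.
Proof. by rewrite /ev1 map_mxZ linearZ. Qed.

Lemma ev1_tens (v : V) : ev1 (tens n v) = v.
Proof.
rewrite /ev1 /tens -map_mx_comp map_mx_id ?v2rK // => x.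
by rewrite /= mevalC.
Qed.

Fact tcoef_is_additive c : zmod_morphism (@tcoef K n V c).
Proof. by move=> w w'; rewrite /tcoef raddfB linearB. Qed.
HB.instance Definition _ c :=
  GRing.isZmodMorphism.Build _ _ (@tcoef K n V c) (tcoef_is_additive c).

Lemma tcoef_eq (w w' : 'rV[S]_(dim V)) : (forall c, tcoef c w = tcoef c w') -> w = w'.
Proof.
move=> eqw; apply/rowP => j; apply/mpolyP => c.
by have /r2v_inj/rowP/(_ j) := eqw c; rewrite !mxE.
Qed.

Lemma mcoeffM_X p k c : ('X_[k] * p)@_c = if (k <= c)%MM then p@_(c - k) else 0.
Proof.
rewrite mulrC; case: ifP => [lekc|nlekc].
  by rewrite -[in LHS](submK lekc) addmC mcoeffMX.
rewrite [p]mpolyE mulr_suml raddf_sum big1 //= => m _.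
rewrite -scalerAl -mpolyXD mcoeffZ mcoeffX; case: eqP => [mk|_]; last by rewrite mulr0.
by move: nlekc; rewrite -mk lem_addl.
Qed.

Lemma tcoef_X k c (w : 'rV[S]_(dim V)) :
  tcoef c ('X_[k] *: w) = if (k <= c)%MM then tcoef (c - k)%MM w else 0.
Proof.
rewrite /tcoef; case: ifP => kc.
  by congr r2v; apply/rowP => j; rewrite !mxE mcoeffM_X kc.
by rewrite (_ : map_mx _ _ = 0) ?linear0 //; apply/rowP => j; rewrite !mxE mcoeffM_X kc.
Qed.

Lemma tcoefZ c (x : K) (w : 'rV[S]_(dim V)) : tcoef c (x%:MP *: w) = x *: tcoef c w.
Proof.
by rewrite /tcoef -linearZ; congr r2v; apply/rowP => j; rewrite !mxE mcoeffCM.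
Qed.

Lemma tcoef_tens c (v : V) : tcoef c (tens n v) = if c == 0%MM then v else 0.
Proof.
rewrite /tcoef /tens; case: eqP => [->|/eqP c0].
  rewrite -map_mx_comp map_mx_id ?v2rK // => x.
  by rewrite /= mcoeffC eqxx mulr1.
rewrite (_ : map_mx _ _ = 0) ?linear0 //; apply/rowP => j.
by rewrite !mxE mcoeffC (negbTE c0) mulr0.
Qed.

(** Every monomial takes the value 1; the degree bound [d] makes the sum of the coefficients
    finite. *)
Lemma ev1_sum_tcoef (w : 'rV[S]_(dim V)) : exists d : nat,
  ev1 w = \sum_(c : 'X_{1..n < d}) tcoef c w /\
  forall c, (d <= mdeg c)%N -> tcoef c w = 0.
Proof.
pose d := \max_j msize (w 0%R j); exists d.
have led j : (msize (w 0%R j) <= d)%N by apply: (leq_bigmax j).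
split=> [|c dc].
  rewrite /ev1 /tcoef -linear_sum; congr r2v; apply/rowP => j.
  rewrite summxE !mxE {1}(mpolywE (led j)) raddf_sum; apply: eq_bigr => c _ /=.
  rewrite mevalZ mxE mevalX big1 ?mulr1 // => l _; exact: expr1n.
rewrite /tcoef (_ : map_mx _ _ = 0) ?linear0 //; apply/rowP => j; rewrite !mxE.
by apply/memN_msupp_eq0/negP => /msize_mdeg_lt; rewrite ltnNge (leq_trans (led j)).
Qed.

End PolynomialVectors.

Section PolynomialMaps.
Variables (K : fieldType) (n : nat) (V W : vectType K) (f : 'Hom(V, W)).
Local Notation S := {mpoly K[n]}.

Lemma ev1_tensf (w : 'rV[S]_(dim V)) : ev1 (w *m tensf n f) = f (ev1 w).
Proof.
rewrite /ev1 -r2v_mul_f2mx map_mxM /tensf -map_mx_comp; congr r2v; congr (_ *m _).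
by rewrite map_mx_id // => x; rewrite /= mevalC.
Qed.

Lemma tcoef_tensf c (w : 'rV[S]_(dim V)) : tcoef c (w *m tensf n f) = f (tcoef c w).
Proof.
rewrite /tcoef -r2v_mul_f2mx; congr r2v; apply/rowP => j.
rewrite !mxE raddf_sum; apply: eq_bigr => i _ /=.
by rewrite !mxE mulrC mcoeffCM mulrC.
Qed.

End PolynomialMaps.

(** * Signs and degrees *)

Lemma signrS (R : nzRingType) (m : int) :
  (-1) ^+ `|(m + 1)%R|%N = - (-1) ^+ `|m|%N :> R.
Proof.
case: m => k; first by rewrite -PoszD absz_nat addn1 exprS mulN1r.
rewrite NegzE (_ : - k.+1%:Z + 1 = - k%:Z); last by lia.
by rewrite !abszN !absz_nat exprS mulN1r opprK.
Qed.

Lemma signrD (R : nzRingType) (x y : int) :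
  (-1) ^+ `|(x + y)%R|%N = (-1) ^+ `|x|%N * (-1) ^+ `|y|%N :> R.
Proof.
elim/int_rect: y => [|k IHk|k IHk]; first by rewrite addr0 mulr1.
  by rewrite -addn1 PoszD addrA !signrS IHk mulrN.
apply: oppr_inj; rewrite -mulrN -!signrS -addrA.
by rewrite (_ : - k.+1%:Z + 1 = - k%:Z) //; lia.
Qed.

Lemma ind_inj n : injective (@ind n).
Proof.
move=> B B' /ffunP eqB; apply/setP => l; have := eqB l; rewrite !ffunE.
by case: (l \in B); case: (l \in B').
Qed.

Lemma ind_setU1 n (l : 'I_n) (B : {set 'I_n}) :
  l \notin B -> ind (l |: B) = ind [set l] + ind B.
Proof.
move=> lB; apply/ffunP => k; rewrite !ffunE !inE.
by have [->|_] := eqVneq k l; [rewrite (negbTE lB) addr0|rewrite add0r].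
Qed.

Lemma tdegD n (a b : Zn n) : tdeg (a + b) = tdeg a + tdeg b.
Proof. by rewrite /tdeg -big_split; apply: eq_bigr => l _; rewrite ffunE. Qed.

Lemma tdegN n (a : Zn n) : tdeg (- a) = - tdeg a.
Proof. by rewrite /tdeg -sumrN; apply: eq_bigr => l _; rewrite ffunE. Qed.

Lemma tdeg_ind n (B : {set 'I_n}) : tdeg (ind B) = #|B|%:Z.
Proof.
rewrite /tdeg -sum1_card -[RHS]natz natr_sum [RHS]big_mkcond /=.
by apply: eq_bigr => l _; rewrite ffunE; case: (l \in B).
Qed.

Lemma mdegZD n (c k : 'X_{1..n}) : mdegZ (c + k)%MM = mdegZ c + mdegZ k.
Proof. by apply/ffunP => l; rewrite !ffunE mnmDE PoszD. Qed.

Lemma mdegZ_inj n : injective (@mdegZ n).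
Proof. by move=> c k /ffunP eqc; apply/mnmP => l; have := eqc l; rewrite !ffunE => -[]. Qed.

Lemma mdegZ1 n (l : 'I_n) : mdegZ U_(l) = ind [set l].
Proof. by apply/ffunP => k; rewrite !ffunE inE mnm1E eq_sym; case: eqP. Qed.

Lemma ext_hom_extb (K : fieldType) n (F : {set 'I_n}) : ext_hom (- ind F) (extb K F).
Proof. by move=> G; rewrite ffunE; have [->|_] := eqVneq G F; rewrite ?eqxx. Qed.

(** * The module N as a filtered complex of vector spaces *)

Section SquarefreeModel.
Variables (K : fieldType) (n : nat) (N : Ecomplex K n).
Hypothesis sqN : squarefree_complex N.
Local Notation S := {mpoly K[n]}.
Local Notation comp := (fun p : int * Zn n => @ecomp K n N p.1 p.2).
Implicit Types (m i : int) (a b : Zn n) (B : {set 'I_n}) (c : 'X_{1..n}) (v : N).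

(** [is_grading] speaks of subgroups only; scalars act through the elements [k *: 1] of E, which
    have degree 0. *)
Lemma ecompZ i a k v : ecomp i a v -> ecomp i a (k *: v).
Proof.
move=> va; have k0 : ext_hom 0 (k *: 1 : ext K n).
  move=> F; rewrite (_ : k *: 1 = k *: extb K set0) // !ffunE.
  have [->|F0] := eqVneq F set0; last by rewrite [_ *: _]mulr0 eqxx.
  by move=> _; apply/ffunP => l; rewrite !ffunE inE oppr0.
have := sqE_lact sqN k0 va; rewrite add0r linearZ /= scale_lfunE lact1.
by rewrite id_lfunE.
Qed.

Lemma ecomp_exty i a l v : ecomp i a v -> ecomp i (a - ind [set l]) (lact N (exty K l) v).
Proof. by move=> va; rewrite addrC; apply: (sqE_lact sqN (@ext_hom_extb K n [set l])). Qed.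

Lemma squarefree_proj_exists : exists pr s, grading_proj comp pr s.
Proof.
apply: grading_proj_exists; first exact: sqE_grading sqN.
by move=> [i a] k v; apply: ecompZ.
Qed.

(** The value of [L_mx N m] at x = 1, see [ev1_L_mx]. *)
Definition Ldiff m : 'End(N) :=
  \sum_l lact N (exty K l) + (-1) ^+ `|m|%N *: ediff N.

Lemma LdiffE m v : Ldiff m v =
  \sum_l lact N (exty K l) v + (-1) ^+ `|m|%N *: ediff N v.
Proof. by rewrite /Ldiff add_lfunE sum_lfunE scale_lfunE. Qed.

Lemma exty_sum_sqr : (\sum_l exty K l) * (\sum_l exty K l) = 0 :> ext K n.
Proof.
rewrite mulr_suml (eq_bigr (fun l : 'I_n => \sum_(k : 'I_n | (k < l)%N) exty K l * exty K k +
    \sum_(k : 'I_n | (l < k)%N) exty K l * exty K k)) => [|l _].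
  rewrite big_split /= [X in _ + X](exchange_big_dep xpredT) //= -big_split big1 //= => l _.
  by rewrite -big_split big1 //= => k _; rewrite exty_anti addNr.
rewrite mulr_sumr (bigD1 l) //= exty_sqr add0r (bigID (fun k : 'I_n => (k < l)%N)) /=.
congr (_ + _); apply: eq_bigl => k; rewrite -val_eqE /=; by case: ltngtP.
Qed.

(** The sum of the y_l has square zero and commutes with [ediff]; the two mixed terms cancel because
    the sign of [ediff] alternates with m. *)
Lemma LdiffK m v : Ldiff (m + 1) (Ldiff m v) = 0.
Proof.
have lactE w : \sum_l lact N (exty K l) w = lact N (\sum_l exty K l) w.
  by rewrite linear_sum sum_lfunE.
have diffC w : ediff N (lact N (\sum_l exty K l) w) =
    lact N (\sum_l exty K l) (ediff N w).
  by have /lfunP/(_ w) := ediff_lact N (\sum_l exty K l); rewrite !comp_lfunE.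
have diffK w : ediff N (ediff N w) = 0.
  by have /lfunP/(_ w) := ediffK N; rewrite comp_lfunE zero_lfunE.
rewrite !LdiffE !lactE !linearD !linearZ /= diffC diffK scaler0 scaler0 addr0.
have /lfunP/(_ v) := lactM N (\sum_l exty K l) (\sum_l exty K l).
rewrite comp_lfunE exty_sum_sqr linear0 zero_lfunE => <-.
by rewrite signrS scaleNr add0r addrN.
Qed.

Variables (pr : int * Zn n -> 'End(N)) (s : seq (int * Zn n)).
Hypothesis gp : grading_proj comp pr s.

(* The cohomological degree of N^i_(- B) in calL(N) is i + |B|.               *)
Definition sqproj m B : 'End(N) := pr (m - #|B|%:Z, - ind B).

Lemma sqproj_mem m B v : ecomp (m - #|B|%:Z) (- ind B) (sqproj m B v).
Proof. exact: (gproj_mem gp (m - #|B|%:Z, - ind B)). Qed.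

Lemma sqproj_id m B v : ecomp (m - #|B|%:Z) (- ind B) v -> sqproj m B v = v.
Proof. by move=> va; apply: (gproj_id gp (p := (_, _))). Qed.

Lemma sqproj_exty m B l v : ecomp (m - #|B|%:Z) (- ind B) v ->
  sqproj (m + 1) (l |: B) (lact N (exty K l) v) = lact N (exty K l) v.
Proof.
move=> va; have := ecomp_exty l va; have [lB yv|lB yv] := boolP (l \in B).
  (* For [l] in [B] the degree of y_l v has the entry -2 at [l], which no squarefree degree has, so
     y_l v = 0. *)
  have [->|yv0] := eqVneq (lact N (exty K l) v) 0; first by rewrite linear0.
  have [G /ffunP/(_ l)] := sqE_supp sqN yv yv0.
  by rewrite !ffunE !inE eqxx lB; case: (l \in G).
apply: sqproj_id; rewrite ind_setU1 // cardsU1 lB.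
by congr (ecomp _ _ _): yv; [lia|rewrite opprD addrC].
Qed.

Lemma sqproj_ediff m B v : ecomp (m - #|B|%:Z) (- ind B) v ->
  sqproj (m + 1) B (ediff N v) = ediff N v.
Proof.
move=> va; apply: sqproj_id; have := sqE_diff sqN va.
by rewrite addrAC.
Qed.

Lemma sqproj_orth m B B' v : B != B' -> sqproj m B (sqproj m B' v) = 0.
Proof.
move=> neB; apply: (gproj_neq gp (gproj_mem gp _ _)).
by rewrite xpair_eqE eqr_opp (inj_eq (@ind_inj n)) (negbTE neB) andbF.
Qed.

(** y_l leads from [B] to [l |: B], and [ediff] stays in [B]. *)
Lemma sqproj_filtered : filtered_complex sqproj Ldiff.
Proof.
split=> [m B v|m B B' v|m B v|]; last exact: LdiffK.
- exact/sqproj_id/sqproj_mem.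
- exact: sqproj_orth.
have := sqproj_mem m B v; set w := sqproj m B v => wB.
have expand (B0 : {set 'I_n}) u : B \subset B0 -> sqproj (m + 1) B0 u = u ->
    u = \sum_(B' : {set 'I_n} | B \subset B') sqproj (m + 1) B' u.
  move=> sB u0; rewrite (bigD1 B0) //= u0 big1 ?addr0 // => B' /andP[_ ne].
  by rewrite -u0 sqproj_orth.
rewrite LdiffE.
under [RHS]eq_bigr do rewrite linearD linear_sum linearZ.
rewrite big_split /= -scaler_sumr; congr (_ + _ *: _).
  rewrite exchange_big; apply: eq_bigr => l _ /=.
  by apply: (expand (l |: B)); [apply: subsetUr|apply: sqproj_exty].
by apply: (expand B); last exact: sqproj_ediff.
Qed.

End SquarefreeModel.

(** * Each Z^n-degree of [calL N] compared with the complex at x = 1 *)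

Section CalLModel.
Variables (K : fieldType) (n : nat) (N : Ecomplex K n).
Hypothesis sqN : squarefree_complex N.
Local Notation S := {mpoly K[n]}.
Local Notation comp := (fun p : int * Zn n => @ecomp K n N p.1 p.2).
Local Notation L := 'rV[S]_(dim N).
Implicit Types (m i : int) (a b : Zn n) (B G : {set 'I_n}) (c : 'X_{1..n}) (v : N).
Implicit Types (w : L).

Let grN : is_grading comp := sqE_grading sqN.

Lemma L_comp_sum m b (J : eqType) (r : seq J) (P : pred J) (f : J -> L) :
  {in r, forall k, P k -> L_comp m b (f k)} -> L_comp m b (\sum_(k <- r | P k) f k).
Proof.
move=> hf c /=; rewrite raddf_sum /=.
by apply: (grading_sum grN (p := (_, _))) => k kr Pk; apply: hf.
Qed.

Lemma L_compX m b k w : L_comp m b w -> L_comp m (b + mdegZ k) ('X_[k] *: w).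
Proof.
move=> wb c /=; rewrite tcoef_X; case: ifP => [kc|_]; last first.
  exact: (grading0 grN (_, _)).
have -> : b + mdegZ k - mdegZ c = b - mdegZ (c - k)%MM.
  by rewrite -[in LHS](submK kc) mdegZD opprD addrACA subrr addr0.
exact: wb.
Qed.

Lemma L_compZ m b x w : L_comp m b w -> L_comp m b (x%:MP *: w).
Proof. by move=> wb c /=; rewrite tcoefZ; apply/(ecompZ sqN)/wb. Qed.

Lemma L_comp_tens m a v : ecomp (m + tdeg a) a v -> L_comp m a (tens n v).
Proof.
move=> va c /=; rewrite tcoef_tens; case: eqP => [->|_]; last first.
  exact: (grading0 grN (_, _)).
by rewrite (_ : mdegZ 0 = 0) ?subr0 //; apply/ffunP => l; rewrite !ffunE mnm0E.
Qed.

Lemma L_comp_diff m b w : L_comp m b w -> L_comp (m + 1) b (w *m L_mx N m).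
Proof.
move=> wb c /=; rewrite mulmxDr mulmx_sumr raddfD raddf_sum /=.
apply: (gradingD grN (p := (_, _))).
  apply: (grading_sum grN (p := (_, _))) => l _ _ /=.
  rewrite -scalemxAr tcoef_X; case: ifP => [lc|_]; last exact: (grading0 grN (_, _)).
  have /= := ecomp_exty sqN l (wb (c - U_(l))%MM); rewrite -tcoef_tensf.
  have aE : b - mdegZ (c - U_(l))%MM - ind [set l] = b - mdegZ c.
    by rewrite -[in RHS](submK lc) mdegZD mdegZ1 opprD addrA.
  have -> : tdeg (b - mdegZ (c - U_(l))%MM) = 1 + tdeg (b - mdegZ c).
    by rewrite -aE [in RHS]tdegD tdegN tdeg_ind cards1 [RHS]addrC subrK.
  by rewrite aE addrA.
have -> : (-1) ^+ `|m|%N *: tensf n (ediff N) =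
    ((-1) ^+ `|m|%N)%:MP *: tensf n (ediff N).
  by rewrite rmorphXn /= rmorphN rmorph1.
rewrite -scalemxAr tcoefZ tcoef_tensf; apply: (ecompZ sqN).
by have := sqE_diff sqN (wb c); rewrite addrAC.
Qed.

Lemma ev1_L_mx m w : ev1 (w *m L_mx N m) = Ldiff N m (ev1 w).
Proof.
rewrite LdiffE mulmxDr mulmx_sumr raddfD raddf_sum /=; congr (_ + _).
  apply: eq_bigr => l _.
  by rewrite -scalemxAr ev1Z mevalXU scale1r ev1_tensf.
by rewrite -scalemxAr ev1Z ev1_tensf rmorphXn rmorphN rmorph1.
Qed.

Variables (pr : int * Zn n -> 'End(N)) (s : seq (int * Zn n)).
Hypothesis gp : grading_proj comp pr s.
Local Notation pi := (sqproj pr).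

Lemma L_comp_pr m a b c w : L_comp m b w ->
  pr (m + tdeg (a - mdegZ c), a - mdegZ c) (tcoef c w) =
  if b == a then tcoef c w else 0.
Proof.
move=> wb; have [<-|neb] := eqVneq b a; first exact: (gproj_id gp (p := (_, _)) (wb c)).
apply: (gproj_neq gp (q := (_, _)) (wb c)).
by rewrite xpair_eqE (inj_eq (addIr _)) [a == b]eq_sym (negbTE neb) andbF.
Qed.

Lemma L_comp_fiber m (J : eqType) (r : seq J) (al : J -> Zn n) (f : J -> L) a c :
  {in r, forall k, L_comp m (al k) (f k)} ->
  tcoef c (\sum_(k <- r | al k == a) f k) =
  pr (m + tdeg (a - mdegZ c), a - mdegZ c) (tcoef c (\sum_(k <- r) f k)).
Proof.
move=> hf; rewrite !raddf_sum /= [LHS]big_mkcond.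
by apply: eq_big_seq => k kr; rewrite (L_comp_pr _ _ (hf k kr)).
Qed.

(** The projections of N, applied to the coefficient of each monomial, extract the part of degree
    [a] from both sides. *)
Lemma L_comp_fiber_eq m (J J' : eqType) (r : seq J) (r' : seq J')
    (al : J -> Zn n) (al' : J' -> Zn n) (f : J -> L) (f' : J' -> L) a :
  {in r, forall k, L_comp m (al k) (f k)} ->
  {in r', forall k, L_comp m (al' k) (f' k)} ->
  \sum_(k <- r) f k = \sum_(k <- r') f' k ->
  \sum_(k <- r | al k == a) f k = \sum_(k <- r' | al' k == a) f' k.
Proof.
move=> hf hf' eqf; apply: tcoef_eq => c.
by rewrite (L_comp_fiber _ _ hf) (L_comp_fiber _ _ hf') eqf.
Qed.

(** In a fixed degree [b], distinct monomials have coefficients in distinct degrees of N, so nothing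
    cancels when the coefficients are added. *)
Lemma ev1_inj m b w : L_comp m b w -> ev1 w = 0 -> w = 0.
Proof.
move=> wb; have [d [-> d0]] := ev1_sum_tcoef w => w0.
apply: tcoef_eq => c; rewrite raddf0; have [cd|/d0//] := ltnP (mdeg c) d.
have := congr1 (pr (m + tdeg (b - mdegZ c), b - mdegZ c)) w0.
rewrite linear0 linear_sum (bigD1 (BMultinom cd)) //= (L_comp_pr _ _ wb) eqxx.
rewrite big1 ?addr0 // => c' nec.
have nec' : (c == c' :> 'X_{1..n}) = false by rewrite eq_sym; apply/negbTE.
apply: (gproj_neq gp (q := (_, _)) (wb c')); rewrite xpair_eqE.
by rewrite (inj_eq (addrI b)) eqr_opp (inj_eq (@mdegZ_inj n)) nec' andbF.
Qed.

Definition suppZ b : {set 'I_n} := [set l | 0 < b l].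
(** The [B] for which the part of N of degree - [B] contributes to [calL N] in nonnegative degrees
    of support [G]. *)
Definition upset G : {set {set 'I_n}} := intv (~: G) setT.

Lemma calL_comp_degree m b c w : L_comp m (- ones n + b) w -> tcoef c w != 0 ->
  exists B, [/\ - ones n + b - mdegZ c = - ind B, B \in upset (suppZ b),
    pi m B (tcoef c w) = tcoef c w & forall l, 0 <= b l].
Proof.
move=> wb w0; have := wb c => /= wc; have [B aE] := sqE_supp sqN wc w0.
have bE l : b l = 1 - (l \in B)%:R + (c l)%:Z.
  by move/ffunP/(_ l): aE; rewrite !ffunE; case: (l \in B) => /=; lia.
exists B; split=> //; last by move=> l; rewrite bE; case: (l \in B) => /=; lia.
  rewrite inE subsetT andbT; apply/subsetP => l; rewrite !inE bE.
  by case: (l \in B) => //=; lia.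
by apply: (sqproj_id gp); move: wc; rewrite aE tdegN tdeg_ind.
Qed.

Lemma calL_comp_neg m b w l : b l < 0 -> L_comp m (- ones n + b) w -> w = 0.
Proof.
move=> bl wb; apply: tcoef_eq => c; rewrite raddf0.
have [//|/(calL_comp_degree wb)[B [_ _ _ /(_ l)]]] := eqVneq (tcoef c w) 0.
by rewrite leNgt bl.
Qed.

Lemma ev1_cochain m b w : L_comp m (- ones n + b) w ->
  ev1 w \in cochain pi m (upset (suppZ b)).
Proof.
move=> wb; have [d [-> _]] := ev1_sum_tcoef w; apply: memv_suml => c _.
have [->|/(calL_comp_degree wb)[B [_ BP <- _]]] := eqVneq (tcoef c w) 0; first exact: mem0v.
have fc := sqproj_filtered sqN gp.
apply/(cochainP fc); rewrite prpE (bigD1 B) //= (filt_id fc) big1 ?addr0 //.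
by move=> B' /andP[_ ne]; rewrite (filt_orth fc).
Qed.

Lemma ev1_surj m b v : (forall l, 0 <= b l) -> v \in cochain pi m (upset (suppZ b)) ->
  exists2 w, L_comp m (- ones n + b) w & ev1 w = v.
Proof.
move=> b0 /(cochainP (sqproj_filtered sqN gp)); rewrite prpE => vE.
(* The exponent that leads from degree - [B] to degree b - 1. The truncated subtraction is exact,
   since [b l] is positive for [l] outside [B]. *)
pose e (B : {set 'I_n}) := [multinom (`|b l|%N - (l \notin B))%N | l < n].
exists (\sum_(B in upset (suppZ b)) 'X_[e B] *: tens n (pi m B v)); last first.
  rewrite -[RHS]vE raddf_sum; apply: eq_bigr => B _ /=.
  rewrite ev1Z ev1_tens mevalX big1 ?scale1r // => l _; exact: expr1n.
apply: L_comp_sum => B _ BP.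
have -> : - ones n + b = - ind B + mdegZ (e B).
  apply/ffunP => l; rewrite !ffunE mnmE.
  have := b0 l; have [lB|lB] := boolP (l \in B) => /=; first by lia.
  suff : 0 < b l by lia.
  move: BP; rewrite inE => /andP[/subsetP/(_ l) sB _].
  by apply: contraNT lB => nb; apply: sB; rewrite !inE.
apply: L_compX; apply: L_comp_tens; rewrite tdegN tdeg_ind.
exact: (sqproj_mem gp).
Qed.

Section Degree.
Variables (m : int) (b : Zn n).
Hypothesis b0 : forall l, 0 <= b l.
Local Notation P := (upset (suppZ b)).

Lemma cdiff_ev1 m' w : L_comp m' (- ones n + b) w ->
  cdiff pi (Ldiff N) m' P (ev1 w) = ev1 (w *m L_mx N m').
Proof.
move=> wb; rewrite comp_lfunE -ev1_L_mx.
by apply/(cochainP (sqproj_filtered sqN gp))/ev1_cochain/L_comp_diff.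
Qed.

Lemma cocycle_ev1 w : L_comp m (- ones n + b) w ->
  (w *m L_mx N m = 0) <-> (ev1 w \in cocycles pi (Ldiff N) m P).
Proof.
move=> wb; rewrite memv_cap ev1_cochain // memv_ker cdiff_ev1 //.
split=> [->|/eqP]; first by rewrite raddf0 eqxx.
exact/ev1_inj/(L_comp_diff wb).
Qed.

Lemma coboundary_ev1 w : L_comp m (- ones n + b) w ->
  @coboundary K n (calL N) m b w <-> (ev1 w \in cobounds pi (Ldiff N) (m - 1) P).
Proof.
move=> wb; split=> [[u ub <-]|/memv_imgP[_ /(ev1_surj b0)[u ub <-] wE]].
  by rewrite /= -cdiff_ev1 // memv_img // ev1_cochain.
exists u => //=; apply/eqP; rewrite -subr_eq0; apply/eqP.
move: wE; rewrite cdiff_ev1 // => wE.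
apply: (@ev1_inj m (- ones n + b)); last by rewrite raddfB /= wE subrr.
move=> c /=; rewrite raddfB /=; apply: (gradingB grN (p := (_, _))).
  by have := L_comp_diff ub c; rewrite /= subrK.
exact: wb.
Qed.

(** A basis of a complement of the coboundaries in the cocycles is lifted through [ev1]. The
    coordinates of a class are unique because the complement meets the coboundaries in 0. *)
Lemma cohom_dim_hdim : cohom_dim (calL N) m b (hdim pi (Ldiff N) m P).
Proof.
set Z := cocycles pi (Ldiff N) m P; set B := cobounds pi (Ldiff N) (m - 1) P.
have sBZ : (B <= Z)%VS.
  exact/(cobounds_sub (sqproj_filtered sqN gp))/convex_intv.
have dE : hdim pi (Ldiff N) m P = \dim (Z :\: B).
  have := dimv_cap_compl Z B; rewrite (capv_idPr sBZ) /hdim -/Z -/B; lia.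
rewrite {}dE; pose X := vbasis (Z :\: B).
have XZ k : X`_k \in Z.
  have [lt|le] := ltnP k (size X); last by rewrite nth_default ?mem0v.
  by apply: (subvP (diffvSl _ _)); apply: vbasis_mem; apply: mem_nth.
have lift (k : 'I_(\dim (Z :\: B))) :
    exists w, L_comp m (- ones n + b) w /\ ev1 w = X`_k.
  have /(cocyclesP)[/(ev1_surj b0)[w wb wE] _] := XZ k.
  by exists w.
have [z zP] := fin_all_exists lift.
exists z => [k|u [ub uc]].
  have [zb zE] := zP k; split=> //; apply/(cocycle_ev1 zb); rewrite zE; exact: XZ.
have subE (x : {ffun 'I_(\dim (Z :\: B)) -> K}) :
    @coboundary K n (calL N) m b (u - \sum_k (x k)%:MP *: z k) <->
    ev1 u - \sum_k x k *: X`_k \in B.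
  rewrite coboundary_ev1.
    rewrite raddfB raddf_sum /=; under eq_bigr => k _.
      rewrite ev1Z mevalC; have [_ ->] := zP k; over.
    by [].
  move=> c /=; rewrite raddfB /=; apply: (gradingB grN (p := (_, _))); first exact: ub.
  have xb : L_comp m (- ones n + b) (\sum_k (x k)%:MP *: z k).
    by apply: L_comp_sum => k _ _; apply: L_compZ; have [] := zP k.
  exact: xb.
have uZ : ev1 u \in Z by apply/(cocycle_ev1 ub).
have [x [uB uniq]] : exists x : {ffun 'I_(\dim (Z :\: B)) -> K},
    ev1 u - \sum_k x k *: X`_k \in B /\
    forall y : {ffun 'I_(\dim (Z :\: B)) -> K},
      ev1 u - \sum_k y k *: X`_k \in B -> x = y; last first.
  by exists x; split=> [|y /subE/uniq]; first exact/subE.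
have : ev1 u \in (Z :\: B + B)%VS by rewrite addv_diff (subvP (addvSl _ _)).
case/memv_addP => u1 u1X [u2 u2B uE].
exists [ffun k => coord X k u1]; split.
  rewrite uE (eq_bigr (fun k => coord X k u1 *: X`_k)) => [|k _]; last by rewrite ffunE.
  by rewrite -(coord_vbasis u1X) addrC addKr.
move=> y; rewrite uE -addrA addrCA => yB.
have yX : u1 - \sum_k y k *: X`_k \in (Z :\: B)%VS.
  by rewrite memvB // memv_suml // => k _; rewrite memvZ ?vbasis_mem ?mem_nth ?size_tuple.
have : u1 - \sum_k y k *: X`_k \in ((Z :\: B) :&: B)%VS.
  rewrite memv_cap yX; move: yB; rewrite [u2 + _]addrC => yB.
  by rewrite -(addrK u2 (u1 - _)) memvB.
rewrite capv_diff memv0 subr_eq0 => /eqP u1E.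
apply/ffunP => k; rewrite ffunE u1E coord_sum_free //.
exact/basis_free/vbasisP.
Qed.

Lemma cohom_zero_hdim :
  cohom_zero (calL N) m b <-> hdim pi (Ldiff N) m P = 0%N.
Proof.
have sBZ : (cobounds pi (Ldiff N) (m - 1) P <= cocycles pi (Ldiff N) m P)%VS.
  exact/(cobounds_sub (sqproj_filtered sqN gp))/convex_intv.
split=> [z0|/eqP h0 w [wb wc]].
  apply/eqP; rewrite subn_eq0; apply/dimvS/subvP => v vZ.
  have /cocyclesP[/(ev1_surj b0)[w wb wE] _] := vZ.
  rewrite -wE; apply/(coboundary_ev1 wb)/z0; split=> //.
  by apply/(cocycle_ev1 wb); rewrite wE.
apply/(coboundary_ev1 wb).
move: h0; rewrite subn_eq0 => h0.
suff /eqP-> : cobounds pi (Ldiff N) (m - 1) P == cocycles pi (Ldiff N) m P.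
  exact/(cocycle_ev1 wb).
by rewrite eqEdim sBZ.
Qed.

End Degree.
End CalLModel.

(** * Annihilators and minimal primes of the cohomology *)

Lemma sum_fibers (V : zmodType) (J I : eqType) (r : seq J) (al : J -> I) (f : J -> V) :
  \sum_(k <- r) f k =
  \sum_(a <- undup (map al r)) \sum_(k <- r | al k == a) f k.
Proof.
rewrite (exchange_big_dep xpredT) //=; apply: eq_big_seq => k kr.
rewrite [RHS]big_mkcond (bigD1_seq (al k)) ?undup_uniq ?mem_undup ?map_f //=.
by rewrite eqxx big1 ?addr0 // => a; rewrite eq_sym => /negbTE->.
Qed.

Section MinimalPrimes.
Variables (K : fieldType) (n : nat) (N : Ecomplex K n).
Hypothesis sqN : squarefree_complex N.
Local Notation S := {mpoly K[n]}.
Local Notation comp := (fun p : int * Zn n => @ecomp K n N p.1 p.2).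
Variables (pr : int * Zn n -> 'End(N)) (s : seq (int * Zn n)).
Hypothesis gp : grading_proj comp pr s.
Local Notation L := 'rV[S]_(dim N).
Local Notation M := (calL N).
Local Notation hd G j := (hdim (sqproj pr) (Ldiff N) j (upset G)).
Implicit Types (i j : int) (a b : Zn n) (F G U : {set 'I_n}).

Lemma ind_ge0 G l : 0 <= ind G l.
Proof. by rewrite ffunE; case: (l \in G). Qed.

Lemma suppZ_ind G : suppZ (ind G) = G.
Proof. by apply/setP => l; rewrite inE ffunE; case: (l \in G). Qed.

Lemma cohom_zero_ind i G : cohom_zero M i (ind G) <-> hd G i = 0%N.
Proof. by rewrite (cohom_zero_hdim sqN gp) ?suppZ_ind //; apply: ind_ge0. Qed.

Lemma sterm_sum i (J : eqType) (r : seq J) (al : J -> Zn n) (f : J -> L) :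
  {in r, forall k, @scomp K n M i (al k) (f k)} ->
  @sterm K n M i (\sum_(k <- r) f k).
Proof.
move=> hf; exists (undup (map al r)), (fun a => \sum_(k <- r | al k == a) f k).
split; last exact: sum_fibers.
move=> a; apply: (L_comp_sum sqN) => k kr /eqP<-; exact: hf.
Qed.

Lemma scomp_diff i a (z : L) : @scomp K n M (i - 1) a z ->
  @scomp K n M i a (z *m L_mx N (i - 1)).
Proof. by move=> za; have := L_comp_diff sqN za; rewrite subrK. Qed.

Lemma scompX i a c (z : L) : @scomp K n M i a z ->
  @scomp K n M i (a + mdegZ c) ('X_[c] *: z).
Proof. by move=> za; have := L_compX sqN c za; rewrite -addrA. Qed.

(** Multiplication by this product moves every nonnegative degree to one whose support contains [U],
    where the cohomology vanishes; degrees with a negative entry carry nothing. *)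
Lemma cohom_ann_prod i U : (forall G, U \subset G -> hd G i = 0%N) ->
  cohom_ann M i (\prod_(l in U) 'X_l : S).
Proof.
move=> hU; pose e : 'X_{1..n} := [multinom (l \in U : nat) | l < n].
have -> : \prod_(l in U) 'X_l = 'X_[e] :> S.
  rewrite mpolyXE_id big_mkcond; apply: eq_bigr => l _.
  by rewrite mnmE; case: (l \in U); rewrite ?expr0 ?expr1.
move=> z [t [f [hf zE]]] /= dz.
pose f' a : L := \sum_(b <- t | b == a) f b.
have f'c a : @scomp K n M i a (f' a).
  by apply: (L_comp_sum sqN) => b _ /eqP<-; apply: hf.
have f'd a : f' a *m L_mx N i = 0.
  (* Zero is written as an empty sum so that [L_comp_fiber_eq] extracts the component of degree [a]
     from the vanishing differential of [z]. *)
  have <- : \sum_(b <- Nil (Zn n) | b == - ones n + a) (0 : L) = 0 by rewrite big_nil.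
  rewrite mulmx_suml (eq_bigl (fun b => - ones n + b == - ones n + a)) => [|b]; last first.
    by rewrite (inj_eq (addrI _)).
  apply: (L_comp_fiber_eq gp (m := i + 1)) => //.
    by move=> b _; apply/(L_comp_diff sqN)/hf.
  by rewrite big_nil -mulmx_suml -zE.
pose t' := undup (map id t).
have lift (k : 'I_(size t')) : exists g : L,
    @scomp K n M (i - 1) (tnth (in_tuple t') k + mdegZ e) g /\
    g *m L_mx N (i - 1) = 'X_[e] *: f' (tnth (in_tuple t') k).
  set a := tnth _ k; have [/forallP a0|/forallPn[l al]] := boolP [forall l, 0 <= a l].
    have b0 l : 0 <= (a + mdegZ e) l.
      by rewrite !ffunE addr_ge0.
    have : cohom_zero M i (a + mdegZ e).
      apply/(cohom_zero_hdim sqN gp _ b0)/hU/subsetP => l lU.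
      by have := a0 l; rewrite inE !ffunE mnmE lU ltzD1 /=.
    case/(_ ('X_[e] *: f' a)) => [|g gc ge]; last by exists g.
    by split; [apply: scompX|rewrite /= -scalemxAl f'd scaler0].
  have al0 : a l < 0 by rewrite ltNge.
  have f0 : f' a = 0 by apply: (calL_comp_neg sqN gp al0); apply: f'c.
  exists 0; rewrite mul0mx f0 scaler0; split=> // c /=.
  by rewrite raddf0; apply: (grading0 (sqE_grading sqN) (_, _)).
have [g gP] := fin_all_exists lift.
exists (\sum_(k < size t') g k).
  by apply: sterm_sum => k _; have [+ _] := gP k; apply.
rewrite /= mulmx_suml; under eq_bigr => k _ do have [_ ->] := gP k.
by rewrite -scaler_sumr zE (sum_fibers t id) /= -(big_tnth _ _ t' xpredT f').
Qed.

(** Otherwise some monomial x^c of [t] involves only variables in [G]. Comparing components of one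
    degree, x^c kills the cohomology in degree [G]; but it acts injectively there, because the
    support does not change. *)
Lemma cohom_ann_sub i G t : hd G i <> 0%N -> cohom_ann M i t -> Pideal G t.
Proof.
move=> h0 tann; apply: Pideal_msupp => c ct.
have [/existsP[l /andP[lG cl]]|/existsPn cG] :=
  boolP [exists l, (l \notin G) && (c l != 0%N)]; first by exists l.
case: h0; apply/cohom_zero_ind => z [zc dz].
have zst : @sterm K n M i z.
  have := @sterm_sum i _ [:: ind G] id (fun=> z).
  by rewrite big_seq1; apply=> a; rewrite inE => /eqP->.
have [w [r [g [gc wE]]] /= dw] := tann z zst dz.
have b0 l : 0 <= (ind G + mdegZ c) l.
  by rewrite ffunE addr_ge0 ?ind_ge0 // ffunE.
have suppE : suppZ (ind G + mdegZ c) = G.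
  apply/setP => l; rewrite inE !ffunE; have := cG l.
  by case: (l \in G) => /=; [lia|rewrite negbK => /eqP->].
pose w' : L := \sum_(a <- r | - ones n + a == - ones n + (ind G + mdegZ c)) g a.
have tzE : \sum_(a <- r) (g a : L) *m L_mx N (i - 1) =
    \sum_(c' <- msupp t) (t@_c')%:MP *: ('X_[c'] *: z).
  rewrite -mulmx_suml -wE dw {1}[t]mpolyE scaler_suml; apply: eq_bigr => c' _.
  by rewrite -mul_mpolyC scalerA.
have w'E : w' *m L_mx N (i - 1) = (t@_c)%:MP *: ('X_[c] *: z).
  pose al' (c' : 'X_{1..n}) : Zn n := - ones n + (ind G + mdegZ c').
  transitivity (\sum_(c' <- msupp t | al' c' == al' c) (t@_c')%:MP *: ('X_[c'] *: z)).
    rewrite mulmx_suml; apply: (L_comp_fiber_eq gp (m := i)) => //.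
      by move=> a _; apply/scomp_diff/gc.
    by move=> c' _; apply/(L_compZ sqN)/scompX.
  rewrite (eq_bigl (fun c' => c' == c)) => [|c']; last first.
    by rewrite /al' !(inj_eq (addrI _)) (inj_eq (@mdegZ_inj n)).
  rewrite big_mkcond (bigD1_seq c) //= eqxx big1 ?addr0 // => c' /negbTE-> //.
have tc : t@_c != 0 by rewrite -mcoeff_msupp.
have zXb : @coboundary K n M i (ind G + mdegZ c) ('X_[c] *: z).
  exists ((t@_c)^-1%:MP *: w').
    by apply/(L_compZ sqN)/(L_comp_sum sqN) => a _ /eqP<-; apply: gc.
  rewrite /= -scalemxAl w'E [LHS]scalerA -mpolyCM mulVf // mpolyC1 scale1r //.
(* The degrees [G] and [G] + c have the same support and [ev1] sends x^c to 1, so being a coboundary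
   is the same condition for [z] and for x^c z. *)
apply/(coboundary_ev1 sqN gp (@ind_ge0 G) zc).
move/(coboundary_ev1 sqN gp b0 (scompX c zc)): zXb.
rewrite suppE suppZ_ind ev1Z mevalX big1 ?scale1r // => l _; exact: expr1n.
Qed.

(** Let [U] be the set of variables outside [Q]. If the cohomology vanished in all degrees
    containing [U], the product of these variables would annihilate it and lie in [Q], against
    primality. *)
Lemma prime_over_ann i (Q : S -> Prop) : prime_ideal Q ->
    (forall t, cohom_ann M i t -> Q t) ->
  exists2 G, hd G i <> 0%N & forall t, Pideal G t -> Q t.
Proof.
move=> pQ annQ.
have [U UP] : exists U : {set 'I_n}, forall l, l \in U <-> ~ Q 'X_l.
  have dec l : exists x : bool, x <-> ~ Q 'X_l.
    have [Ql|nQl] := classic (Q 'X_l); first by exists false; split=> // /(_ Ql).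
    by exists true.
  have [x xP] := fin_all_exists dec.
  by exists [set l | x l] => l; rewrite inE.
have [[G [UG hG]]|noG] := classic (exists G, U \subset G /\ hd G i <> 0%N).
  exists G => // t [h ->]; apply: big_ind => [||l lG].
  - exact: prime_ideal0.
  - exact: prime_idealD.
  apply: prime_idealM => //; apply: NNPP => /UP lU.
  by rewrite (subsetP UG) in lG.
have [|l lU] := prime_ideal_prod (f := fun l => 'X_l) (A := mem U) pQ; last first.
  by have /UP := lU.
apply/annQ/cohom_ann_prod => G UG; apply/eqP/negPn/negP => /eqP hG.
by apply: noG; exists G.
Qed.

(** By [cohom_ann_sub] and [prime_over_ann], a prime contains the annihilator exactly when it
    contains P_G for some [G] with nonzero cohomology; and P_G shrinks as [G] grows. *)
Lemma cohom_minimal_primeP F i : cohom_minimal_prime M i (Pideal F) <->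
  (hd F i <> 0%N /\ forall G, F \proper G -> hd G i = 0%N).
Proof.
split=> [[pF annF minF]|[hF maxF]].
  have eqF G : hd G i <> 0%N -> F \subset G -> G = F.
    move=> hG FG; apply/eqP; rewrite eqEsubset FG andbT.
    apply: (@Pideal_sub K); apply: minF; first exact: Pideal_prime.
      by move=> t; apply: cohom_ann_sub.
    by move=> t; apply: Pideal_mono.
  split=> [|G /properP[FG [l lG lF]]].
    by have [G hG /Pideal_sub/(eqF _ hG) <-] := prime_over_ann pF annF.
  apply/eqP/negPn/negP => /eqP/eqF/(_ FG) GF.
  by rewrite GF (negbTE lF) in lG.
split; first exact: Pideal_prime.
  by move=> t; apply: cohom_ann_sub.
move=> Q pQ annQ QF t Ft; have [G hG GQ] := prime_over_ann pQ annQ.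
have FG : F \subset G by apply: (@Pideal_sub K) => u /GQ/QF.
suff GF : G = F by apply: GQ; rewrite GF.
apply/eqP; rewrite eq_sym; apply/negPn/negP => neFG.
by case: hG; apply: maxF; rewrite properEneq neFG.
Qed.

(** Maximality of [F] is the case j = i of the vanishing; for j < i the bound on the size of [G]
    excludes [G] = [F]. *)
Lemma distinguishedP F i : distinguishedE N F i <->
  (hd F i <> 0%N /\ forall G j, F \proper G -> j <= i ->
     #|F|%:Z + i - j <= #|G|%:Z -> hd G j = 0%N).
Proof.
split=> [[/cohom_minimal_primeP[hF maxF] van]|[hF van]].
  split=> // G j pFG; rewrite le_eqVlt => /predU1P[->|ltji] leFG.
    exact: maxF.
  by apply/cohom_zero_ind/van => //; apply: proper_sub.
split.
  apply/cohom_minimal_primeP; split=> // G pFG.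
  by apply: van => //; have := proper_card pFG; lia.
move=> j G ltji FG leFG; apply/cohom_zero_ind/van => //; last exact: ltW.
rewrite properEcard FG; lia.
Qed.

End MinimalPrimes.

(** * Ranks of adjoint maps *)

Section AdjointRank.
Variables (K : fieldType).

(** The kernel of [f] contains the orthogonal of the image of [g], whose codimension is at most the
    rank of [g]. *)
Lemma adjoint_rank_le (V W : vectType K) (be : V -> W -> K) (c : K)
    (f : 'End(V)) (g : 'End(W)) :
    (forall w k x y, be (k *: x + y) w = k * be x w + be y w) ->
    (forall v k x y, be v (k *: x + y) = k * be v x + be v y) ->
    (forall v, (forall w, be v w = 0) -> v = 0) ->
    (forall v w, be (f v) w = c * be v (g w)) ->
  (\dim (limg f) <= \dim (limg g))%N.
Proof.
move=> linl linr nondeg adj; pose X := vbasis (limg g); pose r := \dim (limg g).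
pose h (v : V) : 'rV[K]_r := \row_k be v X`_k.
have lin : linear h by move=> k x y; apply/rowP => j; rewrite !mxE linl.
pose hl : {linear V -> 'rV[K]_r} :=
  HB.pack h (GRing.isLinear.Build K V 'rV[K]_r *:%R h lin).
have ker_sub : (lker (linfun hl) <= lker f)%VS.
  apply/subvP => v; rewrite !memv_ker lfunE /= => /eqP/rowP hv.
  apply/eqP/nondeg => w; rewrite adj.
  rewrite (coord_vbasis (memv_img g (memvf w))).
  pose bv : {linear W -> K^o} :=
    HB.pack (be v : W -> K^o) (GRing.isLinear.Build K W K^o *:%R (be v) (linr v)).
  rewrite -[be v _]/(bv _) linear_sum big1 ?mulr0 // => k _.
  by rewrite linearZ /=; have := hv k; rewrite !mxE => ->; rewrite scaler0.
have := dimvS ker_sub; have := limg_ker_dim f fullv.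
have := limg_ker_dim (linfun hl) fullv; rewrite !capfv.
have := dimvS (subvf (limg (linfun hl))); rewrite [X in (_ <= X)%N]dimvf.
rewrite dim_matrix /r; lia.
Qed.

Lemma adjoint_rank (V W : vectType K) (be : V -> W -> K) (c : K)
    (f : 'End(V)) (g : 'End(W)) : c != 0 ->
    (forall w k x y, be (k *: x + y) w = k * be x w + be y w) ->
    (forall v k x y, be v (k *: x + y) = k * be v x + be v y) ->
    (forall v, (forall w, be v w = 0) -> v = 0) ->
    (forall w, (forall v, be v w = 0) -> w = 0) ->
    (forall v w, be (f v) w = c * be v (g w)) ->
  \dim (limg f) = \dim (limg g).
Proof.
move=> c0 linl linr nondegl nondegr adj; apply/eqP; rewrite eqn_leq.
rewrite (adjoint_rank_le linl linr nondegl adj).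
apply: (@adjoint_rank_le _ _ (fun w v => be v w) c^-1) => // w v.
by rewrite adj mulKf.
Qed.

End AdjointRank.

(** * The exterior algebra as a Frobenius algebra *)

Section ExteriorTop.
Variables (K : fieldType) (n : nat).
Local Notation E := (ext K n).
Implicit Types (u e : E) (A F G : {set 'I_n}).

Lemma ext_mulE u e A : (u * e : E) A =
  \sum_F \sum_G u F * e G * extc K F G * (A == F :|: G)%:R.
Proof.
rewrite [u * e]/(ext_mul u e) /ext_mul sum_ffunE; apply: eq_bigr => F _.
by rewrite sum_ffunE; apply: eq_bigr => G _; rewrite !ffunE.
Qed.

(** The Frobenius form of E: by [ext_top_eq], an element is determined by the top coefficients of
    its multiples. *)
Definition etop (u : E) : K := u setT.

Lemma etopP k u e : etop (k *: u + e) = k * etop u + etop e.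
Proof. by rewrite /etop !ffunE. Qed.

Lemma extc_compl_disj F G : F != ~: G -> extc K F G * (setT == F :|: G)%:R = 0.
Proof.
move=> FG; rewrite /extc; case: ifP => dFG; last by rewrite mul0r.
case: eqP => [FUG|_]; last by rewrite mulr0.
case/eqP: FG; apply/setP => l; rewrite inE; move/setP/(_ l): FUG; rewrite !inE.
have := disjointFr dFG (x := l); case: (l \in F) => [->//|_].
by case: (l \in G).
Qed.

Lemma etop_mulr u A : etop (u * extb K A) = u (~: A) * extc K (~: A) A.
Proof.
rewrite /etop ext_mulE exchange_big (bigD1 A) //= [X in _ + X]big1 ?addr0.
  rewrite (bigD1 (~: A)) //= big1 ?addr0 => [|F FA].
    by rewrite !ffunE eqxx mulr1 setUC setUCr eqxx mulr1.
  by rewrite -mulrA extc_compl_disj ?mulr0.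
by move=> G GA; apply: big1 => F _; rewrite ffunE (negbTE GA) mulr0 !mul0r.
Qed.

Lemma etop_mull u A : etop (extb K A * u) = u (~: A) * extc K A (~: A).
Proof.
rewrite /etop ext_mulE (bigD1 A) //= [X in _ + X]big1 ?addr0.
  rewrite (bigD1 (~: A)) //= big1 ?addr0 => [|F FA].
    by rewrite !ffunE eqxx mul1r setUCr eqxx mulr1.
  by rewrite -mulrA extc_compl_disj ?mulr0 //; apply: contraNneq FA => ->; rewrite setCK.
by move=> G GA; apply: big1 => F _; rewrite ffunE (negbTE GA) !mul0r.
Qed.

Lemma extc_compl_sqr A : extc K A (~: A) * extc K A (~: A) = 1.
Proof.
by rewrite /extc -setI_eq0 setICr eqxx -exprD addnn -signr_odd odd_double.
Qed.

Lemma ext_coefE u A : u A = etop (u * extb K (~: A)) * extc K A (~: A).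
Proof. by rewrite etop_mulr setCK -mulrA extc_compl_sqr mulr1. Qed.

Lemma ext_top_eq u u' : (forall e, etop (u * e) = etop (u' * e)) -> u = u'.
Proof. by move=> eqt; apply/ffunP => A; rewrite !(ext_coefE _ A) eqt. Qed.

(** Each pair in F x G is an inversion in exactly one of the two orders. *)
Lemma inv_count_swap F G : [disjoint F & G] ->
  (inv_count F G + inv_count G F = #|F| * #|G|)%N.
Proof.
move=> dFG; rewrite -cardsX /inv_count.
have swapI : injective (fun p : 'I_n * 'I_n => (p.2, p.1)) by move=> [a b] [a' b'] [-> ->].
rewrite -[X in (_ + X)%N](card_imset _ swapI) -cardsUI.
rewrite [X in (_ + X)%N]eq_card0 ?addn0 => [|[k l]].
  apply: eq_card => -[k l]; rewrite !inE /=.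
  have -> : (k, l) \in [set (p.2, p.1) | p in [set p : 'I_n * 'I_n |
      [&& p.1 \in G, p.2 \in F & (p.2 < p.1)%N]]] = [&& l \in G, k \in F & (k < l)%N].
    apply/imsetP/idP => [[[a b]]|klP]; first by rewrite inE /= => abP [-> ->].
    by exists (l, k); rewrite ?inE.
  case: (boolP (k \in F)) => kF; case: (boolP (l \in G)) => lG //=.
  case: ltngtP => // /val_inj kl; by rewrite kl (disjointFr dFG kF) in lG.
rewrite !inE /=; apply/negP => /andP[/and3P[_ _ lk] /imsetP[[a b]]].
by rewrite inE /= => /and3P[_ _ ba] [ka lb]; move: lk; rewrite ka lb ltnNge (ltnW ba).
Qed.

Lemma extcC F G : extc K F G = (-1) ^+ (#|F| * #|G|) * extc K G F.
Proof.
rewrite /extc [in RHS]disjoint_sym; case: ifP => dFG; last by rewrite mulr0.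
rewrite -(inv_count_swap dFG) exprD -mulrA -[X in _ * X]exprD addnn.
by rewrite -[X in _ * X]signr_odd odd_double mulr1.
Qed.

Lemma ext_hom_mul a b u e : ext_hom a u -> ext_hom b e -> ext_hom (a + b) (u * e).
Proof.
move=> ua eb A; rewrite ext_mulE => nz.
have [F Fnz] : exists F, \sum_G u F * e G * extc K F G * (A == F :|: G)%:R != 0.
  apply/existsP; apply: contraNT nz => /existsPn z; apply/eqP/big1 => F _.
  by apply/eqP; have := z F; rewrite negbK.
have [G] : exists G, u F * e G * extc K F G * (A == F :|: G)%:R != 0.
  apply/existsP; apply: contraNT Fnz => /existsPn z; apply/eqP/big1 => G _.
  by apply/eqP; have := z G; rewrite negbK.
have [->|_] := eqVneq A (F :|: G); last by rewrite mulr0 eqxx.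
rewrite mulr1 !mulf_eq0 !negb_or => /andP[/andP[uF eG]].
rewrite /extc; case: ifP => [dFG _|]; last by rewrite eqxx.
rewrite (ua F uF) (eb G eG); apply/ffunP => l; rewrite !ffunE inE.
have := disjointFr dFG (x := l).
by case: (l \in F) => [->//|_]; case: (l \in G); rewrite ?oppr0 ?addr0 ?add0r.
Qed.

Lemma ext_hom_comm a b u e : ext_hom a u -> ext_hom b e ->
  u * e = (-1) ^+ `|(tdeg a * tdeg b)%R|%N *: (e * u).
Proof.
move=> ua eb; apply/ffunP => A; rewrite ffunE !ext_mulE exchange_big /=.
rewrite [RHS]mulr_sumr; apply: eq_bigr => G _; rewrite mulr_sumr.
apply: eq_bigr => F _; rewrite (setUC G F) mulrA; congr (_ * _).
have [->|uF] := eqVneq (u F) 0; first by rewrite mulr0 !(mul0r, mulr0).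
have [->|eG] := eqVneq (e G) 0; first by rewrite mulr0 !(mul0r, mulr0).
rewrite (ua F uF) (eb G eG) !tdegN !tdeg_ind mulrNN -PoszM absz_nat.
by rewrite extcC (mulrC (e G)) [LHS]mulrCA mulrA.
Qed.

End ExteriorTop.

(** * The pairing of Hom_E(N, E) with N, and squarefreeness of the dual *)

Section DualPairing.
Variables (K : fieldType) (n : nat) (N : Ecomplex K n).
Hypothesis sqN : squarefree_complex N.
Local Notation comp := (fun p : int * Zn n => @ecomp K n N p.1 p.2).
Local Notation H := (DE N).
Implicit Types (i j m : int) (a b : Zn n) (A B : {set 'I_n}) (f : H) (v w : N).

Definition pairing f v : K := etop (vsval f v).

Lemma pairingDl v k f g : pairing (k *: f + g) v = k * pairing f v + pairing g v.
Proof. by rewrite /pairing linearP add_lfunE scale_lfunE etopP. Qed.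

Lemma pairingDr f k v w : pairing f (k *: v + w) = k * pairing f v + pairing f w.
Proof. by rewrite /pairing linearP etopP. Qed.

Fact pairing_is_linear f : linear (pairing f : N -> K^o).
Proof. by move=> k v w; rewrite pairingDr. Qed.
HB.instance Definition _ f := GRing.isLinear.Build K N K^o *:%R
  (pairing f : N -> K^o) (pairing_is_linear f).

Definition pairingl v f : K := pairing f v.

Fact pairingl_is_linear v : linear (pairingl v : H -> K^o).
Proof. by move=> k f g; rewrite /pairingl pairingDl. Qed.
HB.instance Definition _ v := GRing.isLinear.Build K H K^o *:%R
  (pairingl v : H -> K^o) (pairingl_is_linear v).

Lemma pairing0l v : pairing 0 v = 0.
Proof. exact: (linear0 (pairingl v : H -> K^o)). Qed.

Lemma pairing0r f : pairing f 0 = 0.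
Proof. exact: (linear0 (pairing f : N -> K^o)). Qed.

Lemma pairingZr f k v : pairing f (k *: v) = k * pairing f v.
Proof. exact: (linearZ_LR (pairing f : N -> K^o)). Qed.

Lemma pairingZl k f v : pairing (k *: f) v = k * pairing f v.
Proof. exact: (linearZ_LR (pairingl v : H -> K^o)). Qed.

Lemma pairing_addl f g v : pairing (f + g) v = pairing f v + pairing g v.
Proof. exact: (linearD (pairingl v : H -> K^o)). Qed.

Lemma pairing_addr f v w : pairing f (v + w) = pairing f v + pairing f w.
Proof. exact: (linearD (pairing f : N -> K^o)). Qed.

Lemma pairing_subl f g v : pairing (f - g) v = pairing f v - pairing g v.
Proof. exact: (linearB (pairingl v : H -> K^o)). Qed.

Lemma pairing_suml (J : Type) (r : seq J) (P : pred J) (F : J -> H) v :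
  pairing (\sum_(k <- r | P k) F k) v = \sum_(k <- r | P k) pairing (F k) v.
Proof. exact: (linear_sum (pairingl v : H -> K^o)). Qed.

Lemma pairing_sumr (J : Type) (r : seq J) (P : pred J) f (F : J -> N) :
  pairing f (\sum_(k <- r | P k) F k) = \sum_(k <- r | P k) pairing f (F k).
Proof. exact: (linear_sum (pairing f : N -> K^o)). Qed.

Lemma pairing_ract f e v : pairing f (ract N e v) = etop (vsval f v * e).
Proof. by rewrite /pairing; have /homEP-> := subvsP f. Qed.

Lemma pairing_eq0l f : (forall v, pairing f v = 0) -> f = 0.
Proof.
move=> f0; apply: (@dual_eq _ _ N) => v; apply: ext_top_eq => e.
by rewrite -!pairing_ract !f0 /pairing linear0 zero_lfunE /etop ffunE.
Qed.

(** E is Frobenius, so a K-linear form on N is the top coefficient of an E-linear map to E. *)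
Lemma pairing_surj (phi : 'Hom(N, K^o)) : exists f, forall v, pairing f v = phi v.
Proof.
(* The coefficients are forced by [ext_coefE] and [pairing_ract]. *)
pose g v : ext K n := [ffun A => extc K A (~: A) * phi (ract N (extb K (~: A)) v)].
have gE v e : etop (g v * e) = phi (ract N e v).
  rewrite {1}[e]extE mulr_sumr [e in RHS]extE linear_sum sum_lfunE linear_sum /=.
  rewrite {1}/etop sum_ffunE; apply: eq_bigr => A _.
  rewrite -scalerAr linearZ /= scale_lfunE linearZ /= ffunE; congr (_ * _).
  have := etop_mulr (g v) A; rewrite /etop => ->.
  have := extc_compl_sqr K (~: A); rewrite setCK => sqr1.
  by rewrite ffunE setCK mulrAC sqr1 mul1r.
have lin : linear g.
  move=> k v w; apply: ext_top_eq => e.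
  by rewrite mulrDl -scalerAl etopP !gE linearP linearP.
pose gl : {linear N -> ext K n} :=
  HB.pack g (GRing.isLinear.Build K N (ext K n) *:%R g lin).
have gH : linfun gl \in homE N.
  apply/homEP => e v; rewrite !lfunE; apply: ext_top_eq => e'.
  rewrite [in LHS]/= [in RHS]/= -mulrA !gE.
  by have /lfunP/(_ v) := ractM N e e'; rewrite comp_lfunE => ->.
exists (vsproj (homE N) (linfun gl)) => v.
rewrite /pairing vsprojK // lfunE /= -[g v]mulr1 gE.
by have /lfunP/(_ v) := ract1 N; rewrite id_lfunE => ->.
Qed.

Lemma pairing_eq0r v : (forall f, pairing f v = 0) -> v = 0.
Proof.
move=> v0; rewrite (coord_vbasis (memvf v)) big1 // => k _.
have [f fE] := pairing_surj (linfun (coord (vbasis fullv) k : N -> K^o)).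
by have := fE v; rewrite v0 lfunE /= => <-; rewrite scale0r.
Qed.

Lemma ecomp_ract i a B v : ecomp i a v -> ecomp i (a - ind B) (ract N (extb K B) v).
Proof.
move=> va; have := sqE_sign sqN (@ext_hom_extb K n B) va.
have := sqE_lact sqN (@ext_hom_extb K n B) va; rewrite addrC => ya yE.
have := ecompZ sqN ((-1) ^+ `|(tdeg (- ind B) * tdeg a)%R|%N) ya.
by rewrite yE scalerA -exprD addnn -signr_odd odd_double scale1r.
Qed.

(** Each coefficient of [f v] is, up to sign, the pairing of [f] with a right multiple of [v]. The
    top coefficient has degree -1, so only the degree - 1 - a of N^(-i) may pair nontrivially. *)
Lemma dual_compP i a f : @ecomp K n H i a f <->
  (forall j b v, ecomp j b v -> (j, b) != (- i, - ones n - a) -> pairing f v = 0).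
Proof.
have oneE : - ind [set: 'I_n] = - ones n :> Zn n.
  by apply/ffunP => l; rewrite !ffunE inE.
split=> [fa j b v vb|f0 j b v vb].
  have := fa j b v vb; rewrite xpair_eqE; case: (j == - i) => /= [fv ab|fv0 _]; last first.
    by rewrite /pairing fv0 /etop ffunE.
  apply/eqP; apply: contraNT ab => /fv/eqP; rewrite oneE => abE.
  by rewrite eq_sym subr_eq addrC eq_sym.
have coef A : vsval f v A = pairing f (ract N (extb K (~: A)) v) * extc K A (~: A).
  by rewrite ext_coefE pairing_ract.
case: (boolP (j == - i)) => ji; last first.
  apply/ffunP => A; rewrite coef ffunE (f0 _ _ _ (ecomp_ract _ vb)) ?mul0r //.
  by rewrite xpair_eqE (negbTE ji).
move=> A; rewrite coef.
have [/eqP|ne] := boolP ((j, b - ind (~: A)) == (- i, - ones n - a)); last first.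
  by rewrite (f0 _ _ _ (ecomp_ract _ vb) ne) mul0r eqxx.
case=> _ bE _; apply/ffunP => l; move/ffunP/(_ l): bE.
by rewrite !ffunE inE; case: (l \in A) => /=; lia.
Qed.

Lemma dual_grading : is_grading (fun p : int * Zn n => @ecomp K n H p.1 p.2).
Proof.
have [pr [s gp]] := squarefree_proj_exists sqN.
split=> [[i a]|[i a] f g fa ga|f|t g ut hg g0 [i a] it] /=.
- apply/dual_compP => j b v _ _; exact: pairing0l.
- apply/dual_compP => j b v vb ne; rewrite pairing_subl.
  by rewrite (proj1 (dual_compP i a f) fa j b v vb ne)
    (proj1 (dual_compP i a g) ga j b v vb ne) subrr.
(* The components of [f] are obtained by restricting its linear form to the homogeneous parts of
   N. *)
- have lift (k : 'I_(size s)) : exists g : H, forall v,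
      pairing g v = pairing f (pr (tnth (in_tuple s) k) v).
    have [g gE] := pairing_surj (linfun (pairing f : N -> K^o) \o pr (tnth (in_tuple s) k))%VF.
    by exists g => v; rewrite gE comp_lfunE lfunE.
  have [g gE] := fin_all_exists lift.
  pose al (k : 'I_(size s)) := (- (tnth (in_tuple s) k).1, - ones n - (tnth (in_tuple s) k).2).
  have hg k : @ecomp K n H (al k).1 (al k).2 (g k).
    apply/dual_compP => j b v vb ne; rewrite gE (gproj_neq gp (q := (j, b)) vb) ?pairing0r //.
    by move: ne; rewrite eq_sym /al /= opprK opprB addrC subrK -surjective_pairing.
  exists (undup (map al (enum 'I_(size s)))).
  exists (fun p => \sum_(k <- enum 'I_(size s) | al k == p) g k); split=> [p|].
    apply: big_ind => [|f1 f2 h1 h2|k /eqP<-]; last exact: hg.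
      apply/dual_compP => j b v _ _; exact: pairing0l.
    apply/dual_compP => j b v vb ne; rewrite pairing_addl.
    by rewrite (proj1 (dual_compP p.1 p.2 f1) h1 j b v vb ne)
      (proj1 (dual_compP p.1 p.2 f2) h2 j b v vb ne) addr0.
  rewrite -(sum_fibers _ al); apply/eqP; rewrite -subr_eq0; apply/eqP.
  apply: pairing_eq0l => v; rewrite pairing_subl.
  rewrite pairing_suml big_enum /=.
  rewrite (eq_bigr _ (fun k _ => gE k v))
    -(big_tnth _ _ s xpredT (fun p => pairing f (pr p v))).
  by rewrite -pairing_sumr -(gproj_sum gp) subrr.
apply: pairing_eq0l => v; rewrite (gproj_sum gp v) pairing_sumr.
apply: big1 => q _ /=; have qv := gproj_mem gp q v.
have [qE|ne] := eqVneq (q.1, q.2) (- i, - ones n - a); last first.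
  exact: (proj1 (dual_compP i a _) (hg (i, a)) _ _ _ qv ne).
(* Against an element of the degree dual to [(i, a)], all other terms of the sum pair to zero. *)
have := congr1 (pairing^~ (pr q v)) g0.
rewrite pairing0l pairing_suml (bigD1_seq (i, a)) //=.
rewrite big1 ?addr0 // => -[i' a'] ne;
  apply: (proj1 (dual_compP i' a' _) (hg (i', a')) _ _ _ qv).
rewrite qE; apply: contraNneq ne => -[/oppr_inj-> /addrI/oppr_inj->] //.
Qed.

Lemma squarefree_DE : squarefree_complex (DE N).
Proof.
have [pr [s gp]] := squarefree_proj_exists sqN.
split=> [|i a b e f ea fb|i a b e f ea fb|i a f fa|i a f fa f0].
- exact: dual_grading.
- move=> j c v vc; have := fb j c v vc; rewrite dual_lactE; case: ifP => _; last first.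
    by move->; rewrite mulr0.
  by move=> fv; rewrite -addrA; apply: ext_hom_mul.
- apply: (@dual_eq _ _ N) => v; rewrite (gproj_sum gp v) !linear_sum; apply: eq_bigr => q _.
  have := gproj_mem gp q v; move: (pr q v) => w wq.
  set k := `|_|%N; change (vsval (lact H e f) w = vsval ((-1) ^+ k *: ract H e f) w).
  have -> : vsval ((-1) ^+ k *: ract H e f) w = (-1) ^+ k *: vsval (ract H e f) w.
    exact: (scale_lfunE ((-1) ^+ k) (vsval (ract H e f)) w).
  rewrite dual_lactE dual_ractE.
  rewrite (sqE_sign sqN ea wq) linearZ /=; have /homEP-> := subvsP f.
  have := fb q.1 q.2 w wq; case: ifP => _; last by move->; rewrite mul0r mulr0 !scaler0.
  move=> fw; rewrite (ext_hom_comm ea fw) scalerA -exprD; congr (_ *: _).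
  by rewrite tdegD mulrDr signrD exprD.
- move=> j b v vb; rewrite dual_diffE.
  have := fa _ _ _ (sqE_diff sqN vb).
  by rewrite (_ : (j + 1 == - i) = (j == - (i + 1))) //; lia.
have [v fv] : exists v, pairing f v != 0.
  by apply: NNPP => nov; case/eqP: f0; apply: pairing_eq0l => v;
    apply/eqP/negPn/negP => fv; apply: nov; exists v.
have [q qv] : exists q, pairing f (pr q v) != 0.
  apply: NNPP => noq; case/eqP: fv; rewrite (gproj_sum gp v).
  rewrite pairing_sumr big1 //= => q _.
  by apply/eqP/negPn/negP => fq; apply: noq; exists q.
have wq := gproj_mem gp q v.
have [qE|ne] := eqVneq (q.1, q.2) (- i, - ones n - a); last first.
  by rewrite (proj1 (dual_compP i a f) fa _ _ _ wq ne) eqxx in qv.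
have w0 : pr q v != 0 by apply: contraNneq qv => ->; rewrite pairing0r.
(* The degree dual to [a] is - 1 - a; if it is - [B], then a is minus the indicator of the
   complement of [B]. *)
have [B BE] := sqE_supp sqN wq w0; exists (~: B).
case: qE => _ q2; move: BE; rewrite q2 => /ffunP BE; apply/ffunP => l.
by have := BE l; rewrite !ffunE inE; case: (l \in B) => /=; lia.
Qed.

End DualPairing.

(** * Duality between the complexes of N and of [DE N] *)

Section DualCohomology.
Variables (K : fieldType) (n : nat) (N : Ecomplex K n).
Hypothesis sqN : squarefree_complex N.
Local Notation H := (DE N).
Variables (pr : int * Zn n -> 'End(N)) (s : seq (int * Zn n)).
Hypothesis gp : grading_proj (fun p : int * Zn n => @ecomp K n N p.1 p.2) pr s.
Variables (pr' : int * Zn n -> 'End(H)) (s' : seq (int * Zn n)).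
Hypothesis gp' : grading_proj (fun p : int * Zn n => @ecomp K n H p.1 p.2) pr' s'.
Implicit Types (i j m : int) (a b : Zn n) (A B : {set 'I_n}) (f : H) (v w : N).
Implicit Types (P Q : {set {set 'I_n}}).

Let sqH : squarefree_complex H := squarefree_DE sqN.
Let fc : filtered_complex (sqproj pr) (Ldiff N) := sqproj_filtered sqN gp.
Let fc' : filtered_complex (sqproj pr') (Ldiff H) := sqproj_filtered sqH gp'.

(** Dual degrees pair only with each other, so both sides equal the pairing of the two projected
    elements. *)
Lemma pairing_pr i a f v :
  pairing (pr' (i, a) f) v = pairing f (pr (- i, - ones n - a) v).
Proof.
have duP p g := proj1 (dual_compP sqN p.1 p.2 g).
transitivity (pairing (pr' (i, a) f) (pr (- i, - ones n - a) v)).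
  rewrite {1}(gproj_sum gp v) {1}[pr _ v](gproj_sum gp) !pairing_sumr.
  apply: eq_bigr => q _.
  have qv := gproj_mem gp q v; have [->|ne] := eqVneq q (- i, - ones n - a).
    by rewrite (gproj_id gp (gproj_mem gp _ _)).
  rewrite (gproj_neq gp (gproj_mem gp _ _) ne) pairing0r.
  apply: (duP _ _ (gproj_mem gp' (i, a) f) _ _ _ qv).
  by rewrite -surjective_pairing.
rewrite {2}(gproj_sum gp' f) {1}[pr' _ f](gproj_sum gp') !pairing_suml.
apply: eq_bigr => p _.
have pf := gproj_mem gp' p f; have [->|ne] := eqVneq p (i, a).
  by rewrite (gproj_id gp' (gproj_mem gp' _ _)).
rewrite (gproj_neq gp' (gproj_mem gp' _ _) ne) pairing0l.
rewrite (duP _ _ pf _ _ _ (gproj_mem gp (- i, - ones n - a) v)) //=.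
rewrite xpair_eqE eqr_opp (inj_eq (addrI _)) eqr_opp -xpair_eqE eq_sym.
by rewrite -surjective_pairing.
Qed.

Lemma pairing_sqproj m A f v :
  pairing (sqproj pr' m A f) v = pairing f (sqproj pr (n%:Z - m) (~: A) v).
Proof.
rewrite /sqproj pairing_pr; congr (pairing f (pr (_, _) v)).
  by have := cardsC A; rewrite card_ord; lia.
by apply/ffunP => l; rewrite !ffunE inE; case: (l \in A).
Qed.

Definition compls P : {set {set 'I_n}} := [set ~: A | A in P].

Lemma pairing_prp m P f v : pairing (prp (sqproj pr') m P f) v =
  pairing f (prp (sqproj pr) (n%:Z - m) (compls P) v).
Proof.
rewrite !prpE pairing_suml pairing_sumr big_imset /=; last first.
  by move=> A B _ _; apply: setC_inj.
by apply: eq_bigr => A _; apply: pairing_sqproj.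
Qed.

(* The sign of N_(- B) that turns the differential of L(D_E(N)) into the      *)
(* transpose of the one of L(N).                                              *)
Definition twist m : 'End(N) := \sum_(B : {set 'I_n}) (-1) ^+ 'C(#|B|, 2) *: sqproj pr m B.

Lemma twistE m v : twist m v = \sum_(B : {set 'I_n}) (-1) ^+ 'C(#|B|, 2) *: sqproj pr m B v.
Proof. by rewrite sum_lfunE; apply: eq_bigr => B _; rewrite scale_lfunE. Qed.

Lemma twist_sqproj m B v :
  twist m (sqproj pr m B v) = (-1) ^+ 'C(#|B|, 2) *: sqproj pr m B v.
Proof.
rewrite twistE (bigD1 B) //= (filt_id fc) big1 ?addr0 // => B' ne.
by rewrite (filt_orth fc) // scaler0.
Qed.

Lemma twist_prp m P v : twist m (prp (sqproj pr) m P v) = prp (sqproj pr) m P (twist m v).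
Proof.
have pi_twist B : sqproj pr m B (twist m v) = (-1) ^+ 'C(#|B|, 2) *: sqproj pr m B v.
  rewrite twistE linear_sum (bigD1 B) //= linearZ /= (filt_id fc) big1 ?addr0 // => B' ne.
  by rewrite linearZ /= (filt_orth fc) ?scaler0 // eq_sym.
rewrite twistE [RHS]prpE [RHS]big_mkcond /=; apply: eq_bigr => B _.
by rewrite (pi_prp fc); case: ifP => _; rewrite ?scaler0 // pi_twist.
Qed.

Lemma twistK m v : twist m (twist m v) = prp (sqproj pr) m setT v.
Proof.
rewrite [twist m v]twistE linear_sum [RHS]prpE [RHS]big_mkcond /=.
apply: eq_bigr => B _; rewrite inE linearZ /= twist_sqproj scalerA -exprD addnn.
by rewrite -signr_odd odd_double scale1r.
Qed.

(** Moving y_l from [f] to [v] costs (-1)^(n-1), and turning right into left multiplication costs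
    (-1)^|B|. The second sign is the ratio of the twists at [l |: B] and [B]. For [ediff] the twists
    cancel, and the signs of degrees m and n - m - 1 differ by (-1)^(n+1). *)
Lemma pairing_Ldiff m f B v :
  let M := n%:Z - (m + 1) in
  pairing (Ldiff H m f) (sqproj pr M B v) =
  (-1) ^+ n.+1 * pairing f (twist (M + 1) (Ldiff N M (twist M (sqproj pr M B v)))).
Proof.
move=> M; rewrite twist_sqproj; have wB := sqproj_mem gp M B v.
move: (sqproj pr M B v) wB => w wB.
rewrite linearZ /= linearZ /= pairingZr [Ldiff N _ _]LdiffE [Ldiff H _ _]LdiffE.
rewrite pairing_addl pairing_suml pairingZl.
rewrite linearD linear_sum linearZ /= pairing_addr pairing_sumr pairingZr !mulrDr.
congr (_ + _).
  rewrite !mulr_sumr; apply: eq_bigr => l _.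
  have -> : pairing (lact H (exty K l) f) w = (-1) ^+ n.-1 * pairing f (ract N (exty K l) w).
    rewrite {1}/pairing dual_lactE pairing_ract etop_mull etop_mulr extcC cards1 mul1n.
    by rewrite mulrCA cardsC1 card_ord.
  have -> : pairing f (ract N (exty K l) w) = (-1) ^+ #|B| * pairing f (lact N (exty K l) w).
    rewrite (sqE_sign sqN (@ext_hom_extb K n [set l]) wB) !tdegN !tdeg_ind cards1.
    rewrite mulrNN mul1r pairingZr mulrA -exprD addnn -signr_odd odd_double mul1r //.
  have [lB|lB] := boolP (l \in B).
    suff -> : lact N (exty K l) w = 0 by rewrite !linear0 !mulr0.
    apply: contraTeq lB => /(sqE_supp sqN (ecomp_exty sqN l wB))[G].
    by move/ffunP/(_ l); rewrite !ffunE !inE eqxx; case: (l \in B); case: (l \in G).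
  rewrite -(sqproj_exty sqN gp l wB) twist_sqproj pairingZr cardsU1 lB binS bin1.
  rewrite !mulrA -!exprD; congr (_ * _); rewrite -signr_odd -[RHS]signr_odd.
  have odd_n : odd n = ~~ odd n.-1.
    by rewrite -{1}(prednK (leq_ltn_trans (leq0n l) (ltn_ord l))).
  congr (_ ^+ (nat_of_bool _)); rewrite !oddD /= odd_n.
  by case: (odd n.-1); case: (odd #|B|); case: (odd _).
have signM : (-1) ^+ `|M|%N = (-1) ^+ n.+1 * (-1) ^+ `|m|%N :> K.
  by rewrite /M signrD abszN signrS absz_nat exprS mulrN mulN1r mulNr.
rewrite -(sqproj_ediff sqN gp wB) twist_sqproj !pairingZr signM.
have -> : pairing (ediff H f) w = pairing f (ediff N w) by rewrite /pairing dual_diffE.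
rewrite (sqproj_ediff sqN gp wB) !mulrA -!exprD; congr (_ * _).
rewrite -signr_odd -[RHS]signr_odd; congr (_ ^+ (nat_of_bool _)); rewrite !oddD /=.
by case: (odd n); case: (odd `|m|%N); case: (odd _).
Qed.

Lemma pairing_cdiff m P f v :
  let T := cdiff (sqproj pr) (Ldiff N) (n%:Z - (m + 1)) (compls P) in
  let p := prp (sqproj pr) (n%:Z - (m + 1)) (compls P) in
  pairing (cdiff (sqproj pr') (Ldiff H) m P (prp (sqproj pr') m P f)) v =
  (-1) ^+ n.+1 * pairing f (twist (n%:Z - m) (T (p (twist (n%:Z - (m + 1)) v)))).
Proof.
move=> T p; have M1 : n%:Z - (m + 1) + 1 = n%:Z - m by lia.
rewrite comp_lfunE pairing_prp -/p.
have adj w : w \in cochain (sqproj pr) (n%:Z - (m + 1)) (compls P) ->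
    pairing (Ldiff H m (prp (sqproj pr') m P f)) w = (-1) ^+ n.+1 *
    pairing (prp (sqproj pr') m P f)
      (twist (n%:Z - m) (Ldiff N (n%:Z - (m + 1)) (twist (n%:Z - (m + 1)) w))).
  move=> /(cochainP fc)<-; rewrite [prp _ _ _ w]prpE !linear_sum /= mulr_sumr.
  by apply: eq_bigr => B _; rewrite pairing_Ldiff M1.
rewrite adj ?(mem_cochain fc) // pairing_prp; congr (_ * pairing f _).
by rewrite -twist_prp /T comp_lfunE M1 /p -twist_prp.
Qed.

Lemma dim_cochain_dual m P : \dim (cochain (sqproj pr') m P) =
  \dim (cochain (sqproj pr) (n%:Z - m) (compls P)).
Proof.
apply: (@adjoint_rank _ _ _ (@pairing K n N) 1); first exact: oner_neq0.
- by move=> w k f g; rewrite pairingDl.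
- by move=> f k v w; rewrite pairingDr.
- exact: pairing_eq0l.
- exact: pairing_eq0r.
by move=> f v; rewrite mul1r pairing_prp.
Qed.

(** By [pairing_cdiff] the two differentials are adjoint up to a sign and two twists, and the twists
    preserve the rank. *)
Lemma dim_cobounds_dual m P : \dim (cobounds (sqproj pr') (Ldiff H) m P) =
  \dim (cobounds (sqproj pr) (Ldiff N) (n%:Z - (m + 1)) (compls P)).
Proof.
set M := n%:Z - (m + 1); have M1 : M + 1 = n%:Z - m by rewrite /M; lia.
pose T := cdiff (sqproj pr) (Ldiff N) M (compls P).
pose p := prp (sqproj pr) M (compls P).
rewrite /cobounds /cochain -!limg_comp.
transitivity (\dim (limg (twist (n%:Z - m) \o (T \o p \o twist M)))%VF).
  apply: (@adjoint_rank _ _ _ (@pairing K n N) ((-1) ^+ n.+1)).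
  - by rewrite signr_eq0.
  - by move=> w k f g; rewrite pairingDl.
  - by move=> f k v w; rewrite pairingDr.
  - exact: pairing_eq0l.
  - exact: pairing_eq0r.
  by move=> f v; rewrite comp_lfunE pairing_cdiff !comp_lfunE.
(* The inner twist does not change the image, because [p] absorbs the square of the twist. *)
have -> : limg (twist (n%:Z - m) \o (T \o p \o twist M))%VF =
    (twist (n%:Z - m) @: limg (T \o p)%VF)%VS.
  rewrite limg_comp; congr (_ @: _)%VS; apply/vspaceP => w.
  apply/memv_imgP/memv_imgP => -[v _ ->].
    by exists (twist M v); rewrite ?memvf // comp_lfunE.
  exists (twist M v); rewrite ?memvf // 3!comp_lfunE twistK comp_lfunE /p.
  by rewrite (prp_prp fc) setIT /T comp_lfunE.
(* The outer twist is injective on the image of [T], since its square fixes cochains. *)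
apply: limg_dim_eq; apply/eqP; rewrite -subv0; apply/subvP => w.
rewrite memv_cap memv_ker memv0 => /andP[/memv_imgP[v _ ->] /eqP].
move/(congr1 (twist (n%:Z - m))); rewrite twistK linear0 => <-.
rewrite comp_lfunE /T -M1; apply/eqP/esym/(prp_sub fc (subsetT (compls P))).
exact: (cdiff_cochain fc).
Qed.

Lemma hdim_dual m P : hdim (sqproj pr') (Ldiff H) m P =
  hdim (sqproj pr) (Ldiff N) (n%:Z - m) (compls P).
Proof.
rewrite !hdimE dim_cochain_dual !dim_cobounds_dual subrK.
(* Transposition exchanges the incoming and the outgoing differential, hence the two ranks in
   [hdimE]. *)
by rewrite opprD addrA subnAC.
Qed.

Lemma compls_upset G : compls (upset G) = intv set0 G.
Proof.
apply/setP => B; apply/imsetP/idP => [[A]|].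
  by rewrite inE subsetT andbT => GA ->; rewrite inE sub0set -setCS setCK.
rewrite inE sub0set /= => BG; exists (~: B); last by rewrite setCK.
by rewrite inE subsetT setCS BG.
Qed.

End DualCohomology.

(** * Comparison of the distinguished pairs of N and of its dual *)

Theorem proposition2p6 (K : fieldType) (n : nat) (N : Ecomplex K n)
    (sqN : squarefree_complex N) (F : {set 'I_n}) (i : int) :
  (distinguishedE N F i <->
     distinguishedE (DE N) F ((2 * n)%:Z - #|F|%:Z - i)) /\
  (distinguishedE N F i ->
     exists d : nat,
       cohom_dim (calL N) i (ind F) d /\
       cohom_dim (calL (DE N)) ((2 * n)%:Z - #|F|%:Z - i) (ind F) d).
Proof.
have [pr [s gp]] := squarefree_proj_exists sqN.
have sqH := squarefree_DE sqN; have [pr' [s' gp']] := squarefree_proj_exists sqH.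
have fc := sqproj_filtered sqN gp.
pose h U W j := hdim (sqproj pr) (Ldiff N) j (intv U W).
set i' := _ - i; have cF := cardsC F; rewrite card_ord in cF.
have dualh G m : hdim (sqproj pr') (Ldiff (DE N)) m (upset G) = h set0 G (n%:Z - m).
  by rewrite (hdim_dual sqN gp gp') compls_upset.
have disF : [disjoint ~: F & F] by rewrite -setI_eq0 setIC setICr.
pose strip := strip_vanish (sqproj pr) (Ldiff N) F i.
(* [hdim_strip_edge] for [U] the complement of [F], where the degree is i; the other end has degree
   i - n + |F| = n - i', which is dual to i'. *)
have edge : (forall U W : {set 'I_n}, [disjoint U & F] -> U :|: F \proper W -> strip U W) ->
    h (~: F) setT i = h set0 F (n%:Z - i').
  move=> /(hdim_strip_edge fc)/(_ disF); rewrite setUC setUCr /h.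
  have -> : n%:Z - i' = i - n%:Z + #|F|%:Z by rewrite /i'; lia.
  by have -> : i - n%:Z + #|F|%:Z + #|~: F|%:Z = i by lia.
(* With [U] the complement of [G] and [W] = [n], the window of [strip] is the range of degrees in
   [distinguishedP]. *)
have topP : distinguishedE N F i <-> h (~: F) setT i <> 0%N /\
    forall U W : {set 'I_n}, [disjoint U & F] -> U :|: F \proper W -> strip U W.
  rewrite (distinguishedP sqN gp); split=> -[hF van]; split=> //.
    apply: (strip_vanish_top fc) => U dU pU j lej jle.
    rewrite -[U]setCK; apply: van; last by have := cardsC U; rewrite card_ord; lia.
      rewrite properEneq; apply/andP; split; last by rewrite subsetC -disjoints_subset.
      by apply: contraTneq pU => ->; rewrite setUCr properxx.
    by move: jle; rewrite cardsT card_ord; lia.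
  move=> G j pFG ji leG; apply: (van (~: G) setT); last 1 first.
  - by rewrite cardsT card_ord; lia.
  - by rewrite disjoint_sym disjoints_subset setCK proper_sub.
  - rewrite properT; apply: contraTneq pFG => /setP GF.
    rewrite properE negb_and negbK; apply/orP; right; apply/subsetP => l lG.
    by have := GF l; rewrite !inE lG.
  by have := cardsC G; rewrite card_ord; lia.
(* Here [U] is empty, [W] is [G] and j becomes n - j: the bound j <= i' gives the lower end of the
   window, and the bound on the size of [G] gives the upper end. *)
have botP : distinguishedE (DE N) F i' <-> h set0 F (n%:Z - i') <> 0%N /\
    forall U W : {set 'I_n}, [disjoint U & F] -> U :|: F \proper W -> strip U W.
  rewrite (distinguishedP sqH gp') dualh; split=> -[hF van]; split=> //.
    apply: (strip_vanish_bot fc) => W pW j lej jle.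
    have := van W (n%:Z - j) pW; rewrite dualh subKr; apply.
      by move: lej; rewrite cards0 /i'; lia.
    by rewrite /i'; lia.
  move=> G j pFG ji leG; rewrite dualh; apply: (van set0 G).
  - by rewrite -setI_eq0 set0I.
  - by rewrite set0U.
  - by move: ji; rewrite cards0 /i'; lia.
  by move: leG; rewrite /i'; lia.
split.
  rewrite topP botP; split=> -[hF van]; split=> //; first by rewrite -(edge van).
  by rewrite (edge van).
case/topP=> _ /edge hE; exists (h (~: F) setT i); split.
  by have := cohom_dim_hdim sqN gp i (@ind_ge0 n F); rewrite suppZ_ind.
by have := cohom_dim_hdim sqH gp' i' (@ind_ge0 n F); rewrite suppZ_ind dualh -hE.
Qed.
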